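(* Let $p$ be a prime and let $k$ be a field of characteristic $p$. The following isomorphisms of $k$-algebras hold. (a) The algebras A2 $=k[x,y,z]/\langle x^p, y^p-x, z^p-y\rangle$ and C2 $=k[x,y,z]/\langle x^p-y, y^p-z, z^p\rangle$ are isomorphic to each other and to the group algebra $kC_{p^3}$. (b) The algebras A3 and C4 are equal, both being $k[x,y,z]/\langle x^p,y^p,z^p\rangle$, and they are isomorphic to $k(C_p\times C_p\times C_p)$. (c) The algebras A4 $=k[x,y,z]/\langle x^p,y^p,z^p-x\rangle$ and C3 $=k[x,y,z]/\langle x^p,y^p-z,z^p\rangle$ are isomorphic to each other and to $k(C_p\times C_{p^2})$. (d) The algebra C7 $=k[x,y,z]/\langle x^p,y^p,z^p-z\rangle$ is isomorphic to the direct sum of $p$ copies of $k(C_p\times C_p)$. (e) The algebra C8 $=k[x,y,z]/\langle x^p-y,y^p,z^p-z\rangle$ is isomorphic to the direct sum of $p$ copies of $kC_{p^2}$. (f) The algebra C9 $=k[x,y,z]/\langle x^p,y^p-y,z^p-z\rangle$ is isomorphic to the direct sum of $p^2$ copies of $kC_p$. (g) The algebra C10 $=k\langle x,y,z\rangle/\langle [x,y]-z,[x,z],[y,z],x^p,y^p,z^p-z\rangle$ is isomorphic to the direct sum of $k(C_p\times C_p)$ and $p-1$ copies of the matrix algebra $M_p(k)$.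
   Context: $C_n$ denotes the cyclic group of order $n$, $kG$ the group algebra of a group $G$ over $k$, $k\langle x,y,z\rangle$ the free associative algebra, and $[a,b]=ab-ba$. Direct sums of algebras are direct products of rings. *)

(* Defs.v *)
From HB Require Import structures.
From mathcomp Require Import all_boot all_order all_algebra all_fingroup.
From mathcomp Require Import all_solvable.
From mathcomp Require Import finmap monalg.
From mathcomp Require Import mpoly.
From mathcomp Require Import boolp.

Set Implicit Arguments.
Unset Strict Implicit.
Unset Printing Implicit Defensive.

Import GRing.Theory.
Local Open Scope ring_scope.
Local Open Scope quotient_scope.

(* MathComp's algType requires 1 != 0, which is a property of the parameters   *)
(* for a presented algebra, for {ffun 'I_n -> A} and for 'M_n. Algebras are    *)
(* therefore compared through their (possibly trivial) ring structure and      *)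
(* their scaling; A =~[k] B fills in the canonical scalings of A and B.        *)
Definition alg_iso (k A B : pzRingType) (sA : k -> A -> A) (sB : k -> B -> B) :=
  exists f : {rmorphism A -> B},
    (forall (c : k) (x : A), f (sA c x) = sB c (f x)) /\ bijective f.

Notation "A =~[ k ] B" :=
  (@alg_iso k A B (@GRing.scale k _) (@GRing.scale k _))
  (at level 70, k at level 9, format "A  =~[ k ]  B").

Section QuotientAlgebra.

(* [repr] alone would be the one of fingroup. *)
Local Notation repr := generic_quotient.repr.

Variables (k : comNzRingType) (A : algType k) (rels : seq A).

Definition in_ideal (x : A) : Prop :=
  exists2 s : seq (A * A * A),
    {in s, forall t, t.1.2 \in rels} & x = \sum_(t <- s) t.1.1 * t.1.2 * t.2.

Lemma in_ideal0 : in_ideal 0.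
Proof. by exists [::]; [move=> t; rewrite in_nil|rewrite big_nil]. Qed.

Lemma in_idealD x y : in_ideal x -> in_ideal y -> in_ideal (x + y).
Proof.
move=> [s sr ->] [t tr ->]; exists (s ++ t); last by rewrite big_cat.
by move=> u; rewrite mem_cat => /orP[/sr|/tr].
Qed.

Lemma in_idealMM a b x : in_ideal x -> in_ideal (a * x * b).
Proof.
move=> [s sr ->]; exists [seq (a * t.1.1, t.1.2, t.2 * b) | t <- s].
  by move=> u /mapP[t ts ->] /=; apply: sr.
rewrite big_map mulr_sumr mulr_suml; apply: eq_bigr => t _ /=.
by rewrite !mulrA.
Qed.

Lemma in_idealMl a x : in_ideal x -> in_ideal (a * x).
Proof. by move/(in_idealMM a 1); rewrite mulr1. Qed.

Lemma in_idealMr a x : in_ideal x -> in_ideal (x * a).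
Proof. by move/(in_idealMM 1 a); rewrite mul1r. Qed.

Lemma in_idealN x : in_ideal x -> in_ideal (- x).
Proof. by move/(in_idealMl (-1)); rewrite mulN1r. Qed.

Lemma in_idealZ c x : in_ideal x -> in_ideal (c *: x).
Proof. by move/(in_idealMl (c%:A)); rewrite -scalerAl mul1r. Qed.

Lemma in_ideal_rel r : r \in rels -> in_ideal r.
Proof.
move=> rr; exists [:: (1, r, 1)]; first by move=> t; rewrite inE => /eqP->.
by rewrite big_seq1 mul1r mulr1.
Qed.

Definition cong (x y : A) : bool := `[< in_ideal (x - y) >].

Lemma congP x y : reflect (in_ideal (x - y)) (cong x y).
Proof. exact: asboolP. Qed.

Lemma cong_is_equiv : equiv_class_of cong.
Proof.
split=> [x|x y|y x z].
- by apply/congP; rewrite subrr; exact: in_ideal0.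
- by apply/congP/congP => /in_idealN; rewrite opprB.
- by move=> /congP xy /congP yz; apply/congP; rewrite -(subrKA y); exact: in_idealD.
Qed.

Canonical cong_equiv := EquivRelPack cong_is_equiv.
Canonical cong_encModRel := defaultEncModRel cong.

Definition quot_alg := {eq_quot cong}.

HB.instance Definition _ : EqQuotient A cong quot_alg := EqQuotient.on quot_alg.
HB.instance Definition _ := Choice.on quot_alg.

Definition quot_pi (x : A) : quot_alg := \pi_quot_alg x.

Lemma quot_piW (P : quot_alg -> Prop) :
  (forall x, P (quot_pi x)) -> forall u, P u.
Proof. exact: quotW. Qed.

Lemma quot_eqP x y : quot_pi x = quot_pi y <-> in_ideal (x - y).
Proof.
rewrite /quot_pi; split=> [/eqP|xy]; first by rewrite piE => /congP.
by apply/eqP; rewrite piE; apply/congP.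
Qed.

Lemma quot_repr x : in_ideal (x - repr (quot_pi x)).
Proof. by apply/quot_eqP; rewrite /quot_pi reprK. Qed.

Let zero := quot_pi 0.
Let one := quot_pi 1.
Let opp (u : quot_alg) := quot_pi (- repr u).
Let add (u v : quot_alg) := quot_pi (repr u + repr v).
Let mul (u v : quot_alg) := quot_pi (repr u * repr v).
Let scale c (u : quot_alg) := quot_pi (c *: repr u).

Let piN x : opp (quot_pi x) = quot_pi (- x).
Proof.
by apply/quot_eqP; rewrite opprK addrC; exact: quot_repr.
Qed.

Let piD x y : add (quot_pi x) (quot_pi y) = quot_pi (x + y).
Proof.
apply/esym/quot_eqP; rewrite opprD addrACA.
by apply: in_idealD; exact: quot_repr.
Qed.

Let piM x y : mul (quot_pi x) (quot_pi y) = quot_pi (x * y).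
Proof.
apply/esym/quot_eqP; set x' := repr _; set y' := repr _.
have -> : x * y - x' * y' = (x - x') * y + x' * (y - y').
  by rewrite mulrBl mulrBr addrA subrK.
by apply: in_idealD; [apply: in_idealMr|apply: in_idealMl]; exact: quot_repr.
Qed.

Let piZ c x : scale c (quot_pi x) = quot_pi (c *: x).
Proof.
by apply/esym/quot_eqP; rewrite -scalerBr; apply: in_idealZ; exact: quot_repr.
Qed.

Let addA : associative add.
Proof.
by elim/quot_piW=> x; elim/quot_piW=> y; elim/quot_piW=> z; rewrite !piD addrA.
Qed.

Let addC : commutative add.
Proof. by elim/quot_piW=> x; elim/quot_piW=> y; rewrite !piD addrC. Qed.

Let add0 : left_id zero add.
Proof. by elim/quot_piW=> x; rewrite piD add0r. Qed.

Let addN : left_inverse zero opp add.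
Proof. by elim/quot_piW=> x; rewrite piN piD addNr. Qed.

HB.instance Definition _ :=
  GRing.isZmodule.Build quot_alg addA addC add0 addN.

Let mulA : associative mul.
Proof.
by elim/quot_piW=> x; elim/quot_piW=> y; elim/quot_piW=> z; rewrite !piM mulrA.
Qed.

Let mul1 : left_id one mul.
Proof. by elim/quot_piW=> x; rewrite piM mul1r. Qed.

Let mulr1 : right_id one mul.
Proof. by elim/quot_piW=> x; rewrite piM mulr1. Qed.

Let mulDl : left_distributive mul add.
Proof.
by elim/quot_piW=> x; elim/quot_piW=> y; elim/quot_piW=> z; rewrite !(piD, piM) mulrDl.
Qed.

Let mulDr : right_distributive mul add.
Proof.
by elim/quot_piW=> x; elim/quot_piW=> y; elim/quot_piW=> z; rewrite !(piD, piM) mulrDr.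
Qed.

HB.instance Definition _ :=
  GRing.Zmodule_isPzRing.Build quot_alg mulA mul1 mulr1 mulDl mulDr.

Let scaleA a b u : scale a (scale b u) = scale (a * b) u.
Proof. by elim/quot_piW: u => x; rewrite !piZ scalerA. Qed.

Let scale1 : left_id 1 scale.
Proof. by elim/quot_piW=> x; rewrite piZ scale1r. Qed.

Let scaleDr : right_distributive scale +%R.
Proof.
by move=> a; elim/quot_piW=> x; elim/quot_piW=> y; rewrite /+%R /= !(piD, piZ) scalerDr.
Qed.

Let scaleDl u : {morph scale^~ u : a b / a + b}.
Proof.
by move=> a b; elim/quot_piW: u => x; rewrite [in RHS]/+%R /= !(piD, piZ) scalerDl.
Qed.

HB.instance Definition _ :=
  GRing.Zmodule_isLmodule.Build k quot_alg scaleA scale1 scaleDr scaleDl.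

Lemma quot_pi_zmod_morphism : zmod_morphism quot_pi.
Proof. by move=> x y; rewrite /GRing.add /= /GRing.opp /= piN piD. Qed.

HB.instance Definition _ :=
  GRing.isZmodMorphism.Build A quot_alg quot_pi quot_pi_zmod_morphism.

Lemma quot_pi_monoid_morphism : monoid_morphism quot_pi.
Proof. by split=> [//|x y]; rewrite [in RHS]/*%R /= piM. Qed.

HB.instance Definition _ :=
  GRing.isMonoidMorphism.Build A quot_alg quot_pi quot_pi_monoid_morphism.

Lemma quot_pi_scalable : scalable quot_pi.
Proof. by move=> c x; rewrite [in RHS]/*:%R /= piZ. Qed.

HB.instance Definition _ :=
  GRing.isScalable.Build k A quot_alg *:%R quot_pi quot_pi_scalable.

Lemma quot_scalerAl (c : k) (u v : quot_alg) : c *: (u * v) = (c *: u) * v.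
Proof.
elim/quot_piW: u => x; elim/quot_piW: v => y.
by rewrite -rmorphM -!linearZ -rmorphM /= scalerAl.
Qed.

Lemma quot_scalerAr (c : k) (u v : quot_alg) : c *: (u * v) = u * (c *: v).
Proof.
elim/quot_piW: u => x; elim/quot_piW: v => y.
by rewrite -rmorphM -!linearZ -rmorphM /= scalerAr.
Qed.

Lemma quot_pi_eq0P (x : A) : quot_pi x = 0 <-> in_ideal x.
Proof. by rewrite -[x in in_ideal x]subr0 -quot_eqP. Qed.

End QuotientAlgebra.

(* An alias of {ffun gT -> k}, so as not to inherit its pointwise product. *)
Definition group_alg (k : comNzRingType) (gT : finGroupType) : Type :=
  {ffun gT -> k^o}.

Section GroupAlgebra.

Variables (k : comNzRingType) (gT : finGroupType).
Local Notation kG := (group_alg k gT).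

HB.instance Definition _ := GRing.Lmodule.copy kG {ffun gT -> k^o}.

Implicit Types f g h : {ffun gT -> k^o}.

Definition ga_of (x : gT) : kG := [ffun y => (y == x)%:R].

Definition ga_mul (f g : kG) : kG :=
  [ffun x => \sum_(y : gT) (f : {ffun gT -> k^o}) y
                           * (g : {ffun gT -> k^o}) (y^-1 * x)%g].

Let ga_mulA : associative ga_mul.
Proof.
move=> f g h; apply/ffunP => x; rewrite !ffunE.
under eq_bigr do rewrite ffunE big_distrr /=.
under [RHS]eq_bigr do rewrite ffunE big_distrl /=.
rewrite [RHS]exchange_big /=; apply: eq_bigr => y _.
rewrite [RHS](reindex_inj (mulgI y)) /=; apply: eq_bigr => z _.
by rewrite mulKg invMg !mulgA mulrA.
Qed.

Let ga_mul1l : left_id (ga_of 1%g) ga_mul.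
Proof.
move=> f; apply/ffunP => x; rewrite !ffunE (bigD1 1%g) //= big1 => [|y /negPf y1].
  by rewrite ffunE eqxx mul1r invg1 mul1g addr0.
by rewrite ffunE y1 mul0r.
Qed.

Let ga_mul1r : right_id (ga_of 1%g) ga_mul.
Proof.
move=> f; apply/ffunP => x; rewrite !ffunE (bigD1 x) //= big1 => [|y yx].
  by rewrite ffunE mulVg eqxx mulr1 addr0.
by rewrite ffunE -eq_mulVg1 (negPf yx) mulr0.
Qed.

Let ga_mulDl : left_distributive ga_mul +%R.
Proof.
move=> f g h; apply/ffunP => x; rewrite !ffunE -big_split /=.
by apply: eq_bigr => y _; rewrite ffunE mulrDl.
Qed.

Let ga_mulDr : right_distributive ga_mul +%R.
Proof.
move=> f g h; apply/ffunP => x; rewrite !ffunE -big_split /=.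
by apply: eq_bigr => y _; rewrite ffunE mulrDr.
Qed.

Let ga_1neq0 : ga_of 1%g != 0.
Proof. by apply/eqP => /ffunP/(_ 1%g)/eqP; rewrite !ffunE eqxx oner_eq0. Qed.

HB.instance Definition _ := GRing.Zmodule_isNzRing.Build kG
  ga_mulA ga_mul1l ga_mul1r ga_mulDl ga_mulDr ga_1neq0.

Let ga_scaleAl (c : k) (f g : kG) : c *: (f * g) = (c *: f) * g.
Proof.
apply/ffunP => x; rewrite !ffunE scaler_sumr.
by apply: eq_bigr => y _; rewrite ffunE /*:%R /= mulrA.
Qed.

Let ga_scaleAr (c : k) (f g : kG) : c *: (f * g) = f * (c *: g).
Proof.
apply/ffunP => x; rewrite !ffunE scaler_sumr.
by apply: eq_bigr => y _; rewrite ffunE /*:%R /= mulrCA.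
Qed.

HB.instance Definition _ := GRing.Lmodule_isLalgebra.Build k kG ga_scaleAl.
HB.instance Definition _ := GRing.Lalgebra_isAlgebra.Build k kG ga_scaleAr.

Lemma ga_ofM (x y : gT) : ga_of (x * y)%g = ga_of x * ga_of y.
Proof.
apply/ffunP => u; rewrite !ffunE (bigD1 x) //= big1 => [|v vx].
  by rewrite !ffunE eqxx mul1r addr0 -[in RHS](inj_eq (mulgI x)) mulKVg.
by rewrite ffunE (negPf vx) mul0r.
Qed.

Lemma ga_of_expand (f : kG) :
  f = \sum_(x : gT) ((f : {ffun gT -> k^o}) x : k) *: ga_of x.
Proof.
apply/ffunP => u; rewrite sum_ffunE (bigD1 u) //= big1 => [|v vu].
  by rewrite !ffunE eqxx addr0 /*:%R /= mulr1.
by rewrite !ffunE eq_sym (negPf vu) /*:%R /= mulr0.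
Qed.

End GroupAlgebra.

Lemma malg_scalerAr (k : comNzRingType) (K : monomType) (c : k)
    (u v : {malg k[K]}) :
  c *: (u * v) = u * (c *: v).
Proof.
apply/malgP => m; rewrite monalg.mcoeffZ mcoeffMl.
rewrite (mcoeffMlw m (fsubset_refl _) (monalg.msuppZ_le c v)) mulr_sumr.
apply: eq_bigr => m1 _; rewrite mulr_sumr; apply: eq_bigr => m2 _.
by rewrite monalg.mcoeffZ mulrCA mulrnAr.
Qed.

(* The free algebra on n generators, i.e. the monoid algebra of the free       *)
(* monoid; the library only makes it a left algebra.                           *)
Definition free_alg (k : comNzRingType) (n : nat) : Type :=
  {malg k[{fmonom 'I_n}]}.

HB.instance Definition _ (k : comNzRingType) (n : nat) :=
  GRing.Lalgebra.copy (free_alg k n) {malg k[{fmonom 'I_n}]}.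

HB.instance Definition _ (k : comNzRingType) (n : nat) :=
  GRing.Lalgebra_isAlgebra.Build k (free_alg k n) (@malg_scalerAr k {fmonom 'I_n}).

(* monalg declares the same notation for another construction of the           *)
(* polynomial ring; {mpoly k[3]} below is the type of mpoly.                   *)
Local Notation "{ 'mpoly' T [ n ] }" := (mpoly n T) : type_scope.

Section ConcreteAlgebras.

Variables (k : comNzRingType) (p : nat).

Local Notation x := ('X_(@Ordinal 3 0 isT) : {mpoly k[3]}).
Local Notation y := ('X_(@Ordinal 3 1 isT) : {mpoly k[3]}).
Local Notation z := ('X_(@Ordinal 3 2 isT) : {mpoly k[3]}).

Definition A2 := quot_alg [:: x ^+ p; y ^+ p - x; z ^+ p - y].
Definition A3 := quot_alg [:: x ^+ p; y ^+ p; z ^+ p].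
Definition A4 := quot_alg [:: x ^+ p; y ^+ p; z ^+ p - x].

Definition C2 := quot_alg [:: x ^+ p - y; y ^+ p - z; z ^+ p].
Definition C3 := quot_alg [:: x ^+ p; y ^+ p - z; z ^+ p].
Definition C4 := quot_alg [:: x ^+ p; y ^+ p; z ^+ p].
Definition C7 := quot_alg [:: x ^+ p; y ^+ p; z ^+ p - z].
Definition C8 := quot_alg [:: x ^+ p - y; y ^+ p; z ^+ p - z].
Definition C9 := quot_alg [:: x ^+ p; y ^+ p - y; z ^+ p - z].

Local Notation X := (<< fmu (@Ordinal 3 0 isT) >> : free_alg k 3).
Local Notation Y := (<< fmu (@Ordinal 3 1 isT) >> : free_alg k 3).
Local Notation Z := (<< fmu (@Ordinal 3 2 isT) >> : free_alg k 3).

Definition C10 :=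
  quot_alg [:: X * Y - Y * X - Z; X * Z - Z * X; Y * Z - Z * Y;
               X ^+ p; Y ^+ p; Z ^+ p - Z].

End ConcreteAlgebras.

(* Main.v *)
(* Each isomorphism is given with its inverse, so no dimension is counted. Let  *)
(* Q be a presented algebra and f : Q -> B a morphism killing the relations. A  *)
(* linear g : B -> Q with g 1 = 1, f \o g = id and g (f x * b) = x * g b for    *)
(* every generator x is inverse to f.                                           *)
(* For B = kG with G a product of cyclic p-groups, g maps the generators of G   *)
(* to elements 1 + x with x nilpotent, whose p^n-th power is 1 for large n.     *)
(* A relation z^p = z splits Q along the idempotents e_i = 1 - (z - i)^(p-1),   *)
(* i in F_p, where z e_i = i e_i.                                               *)
(* In C10, z is central: modulo z the generators x and y commute, which gives   *)
(* the factor k(C_p x C_p); where z = i != 0, x and y satisfy the Weyl relation *)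
(* [x, y] = i and act on k[t]/(t^p) as i d/dt and t. The matrix units of M_p    *)
(* are then the elements - y^j x^(p-1) y^(p-1-b), by Wilson's theorem.          *)

Require Import Defs.
From HB Require Import structures.
From mathcomp Require Import all_boot all_order all_algebra all_fingroup.
From mathcomp Require Import all_solvable.
From mathcomp Require Import finmap monalg.
From mathcomp Require Import mpoly.
From mathcomp Require Import ring.

Set Implicit Arguments.
Unset Strict Implicit.
Unset Printing Implicit Defensive.

Import GRing.Theory.
Local Open Scope ring_scope.

(** In characteristic p an element g of order p^n in an abelian group satisfies (g - 1)^(p^n) = 0,
    so the algebra of a product of cyclic p-groups is a truncated polynomial algebra in the elements
    g - 1 for its cyclic generators. In A2, A3, A4, C2 and C3, dropping the generators that a
    relation writes as a p-th power leaves such an algebra: one generator of height p^3, three of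
    height p, or one of height p and one of height p^2. The universal properties ([mpoly_lift] with
    [quot_lift] on one side, [ga_lift] on the other) give maps both ways, which are compared on
    generators by [quot_iso_ga].

    If z^p = z, the Lagrange polynomials of F_p evaluated at z sum to 1 ([sum_eigen_idem]), and z
    acts as the scalar i on the i-th of them ([eigen_idem_mul]). The algebra is thus the product of
    its specialisations z = i, which [quot_iso_ffun_ga] assembles; C9 does this for y and z
    together.

    In C10 the specialisation z = 0 is commutative. For z = i != 0 the operators i d/dt and t on
    k[t]/(t^p) generate all matrices ([matrix_unit_weyl]). That nothing else is left in this part
    comes from [weyl_projE]: the sum u of the lifted matrix units commutes with the generators and
    agrees with z^(p-1) on x^(p-1), and commutators with y then carry this agreement over to
    z^(p-1), which is 1 where z = i. Hence u = 1 there, and the linear map [of_mx] built on the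
    lifted units inverts the representations. *)

Section AlgIso.
Variable k : pzRingType.

Lemma alg_iso_intro (A B : pzRingType) (sA : k -> A -> A) (sB : k -> B -> B)
    (f : {rmorphism A -> B}) (g : B -> A) :
  (forall c x, f (sA c x) = sB c (f x)) -> cancel f g -> cancel g f ->
  alg_iso sA sB.
Proof. by move=> fZ fK gK; exists f; split=> //; exists g. Qed.

Lemma alg_iso_sym (A B : pzRingType) (sA : k -> A -> A) (sB : k -> B -> B) :
  alg_iso sA sB -> alg_iso sB sA.
Proof.
move=> [f [fZ [g fK gK]]].
have gB : zmod_morphism g.
  by move=> x y; rewrite -[in LHS](gK x) -[in LHS](gK y) -rmorphB fK.
have gM : monoid_morphism g.
  split=> [|x y]; first by rewrite -(rmorph1 f) fK.
  by rewrite -[in LHS](gK x) -[in LHS](gK y) -rmorphM fK.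
pose gZ := GRing.isZmodMorphism.Build _ _ g gB.
pose gR := GRing.isMonoidMorphism.Build _ _ g gM.
pose G : {rmorphism B -> A} := HB.pack g gZ gR.
by apply: (@alg_iso_intro _ _ _ _ G f) => // c x; rewrite -[in LHS](gK x) -fZ /= fK.
Qed.

Lemma alg_iso_trans (A B C : pzRingType)
    (sA : k -> A -> A) (sB : k -> B -> B) (sC : k -> C -> C) :
  alg_iso sA sB -> alg_iso sB sC -> alg_iso sA sC.
Proof.
move=> [f [fZ fbij]] [g [gZ gbij]]; exists (g \o f : {rmorphism A -> C}); split.
  by move=> c x /=; rewrite fZ gZ.
exact: bij_comp.
Qed.

End AlgIso.

(** * Morphisms into direct products of rings *)

Section ProductMorphisms.

Lemma ffun_rmorphism (A B : pzRingType) (I : finType)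
    (f : I -> {rmorphism A -> B}) :
  exists F : {rmorphism A -> {ffun I -> B}}, forall x, F x = [ffun i => f i x].
Proof.
pose g x := [ffun i => f i x].
have gB : zmod_morphism g.
  by move=> x y; apply/ffunP=> i; rewrite !ffunE rmorphB.
have gM : monoid_morphism g.
  by split=> [|x y]; apply/ffunP=> i; rewrite !ffunE ?rmorph1 ?rmorphM.
pose G : {rmorphism A -> {ffun I -> B}} :=
  HB.pack g (GRing.isZmodMorphism.Build _ _ g gB)
            (GRing.isMonoidMorphism.Build _ _ g gM).
by exists G.
Qed.

Lemma pair_rmorphism (A B C : pzRingType)
    (f : {rmorphism A -> B}) (g : {rmorphism A -> C}) :
  exists F : {rmorphism A -> (B * C)%type}, forall x, F x = (f x, g x).
Proof.
pose h x := (f x, g x).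
have hB : zmod_morphism h by move=> x y; rewrite /h !rmorphB.
have hM : monoid_morphism h by split=> [|x y]; rewrite /h ?rmorph1 ?rmorphM.
pose H : {rmorphism A -> (B * C)%type} :=
  HB.pack h (GRing.isZmodMorphism.Build _ _ h hB)
            (GRing.isMonoidMorphism.Build _ _ h hM).
by exists H.
Qed.

Lemma ffun_alg_iso_reindex (k : comNzRingType) (B : algType k) (I J : finType)
    (h : J -> I) :
  bijective h -> {ffun I -> B} =~[k] {ffun J -> B}.
Proof.
move=> [h' hK h'K].
pose f (F : {ffun I -> B}) : {ffun J -> B} := [ffun j => F (h j)].
have fB : zmod_morphism f by move=> F G; apply/ffunP=> j; rewrite !ffunE.
have fM : monoid_morphism f by split=> [|F G]; apply/ffunP=> j; rewrite !ffunE.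
pose f' : {rmorphism {ffun I -> B} -> {ffun J -> B}} :=
  HB.pack f (GRing.isZmodMorphism.Build _ _ f fB)
            (GRing.isMonoidMorphism.Build _ _ f fM).
apply: (@alg_iso_intro _ _ _ _ _ f' (fun G => [ffun i => G (h' i)])).
- by move=> c F; apply/ffunP=> j; rewrite !ffunE.
- by move=> F; apply/ffunP=> i; rewrite !ffunE h'K.
- by move=> G; apply/ffunP=> j; rewrite !ffunE hK.
Qed.

End ProductMorphisms.

(** * Generators and universal properties of polynomial and free algebras *)

Section Generation.
Variables (k : comNzRingType).

(** Generation is phrased as an induction principle: words are built from [1] by left
    multiplication, so a linear map needs testing only against left multiplication by generators. *)
Definition generates (A : algType k) (J : Type) (x : J -> A) :=
  forall P : A -> Prop, P 1 -> (forall a b, P a -> P b -> P (a + b)) ->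
  (forall c a, P a -> P (c *: a)) -> (forall j a, P a -> P (x j * a)) ->
  forall a, P a.

Lemma mpoly_generates n :
  generates (fun j : 'I_n => mpolyX k (mnm1 j) : mpoly n k).
Proof.
move=> P P1 PD PZ PX a.
have P0 : P 0 by rewrite -(scale0r 1); exact: PZ.
elim/mpolyind: a => // c m a _ _ Pa; apply: PD => //; apply: PZ.
rewrite mpolyXE_id; elim/big_rec: _ => // i b _ Pb.
by elim: (m i) => [|d IH]; rewrite ?expr0 ?mul1r // exprS -mulrA; exact: PX.
Qed.

(** The images are asked to be central because the targets are group algebras, whose commutativity
    is the lemma [ga_mulC] and not part of their structure. *)
Lemma mpoly_lift n (B : algType k) (v : 'I_n -> B) :
  (forall j b, b * v j = v j * b) ->
  exists f : {lrmorphism mpoly n k -> B},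
    forall j, f (mpolyX k (mnm1 j)) = v j.
Proof.
move=> vC.
pose f : mpoly n k -> B := mpoly.mmap (in_alg B) v.
have fM : monoid_morphism f.
  have [] := @mpoly.commr_mmap_is_multiplicative n k B v (in_alg B).
    by move=> j b; exact: vC.
  by move=> a m m'; rewrite /GRing.comm mulr_algl mulr_algr.
    by split.
have fZ : scalable f by move=> c a; rewrite /f mpoly.mmapZ mulr_algl.
pose F : {lrmorphism mpoly n k -> B} :=
  HB.pack f (GRing.isZmodMorphism.Build _ _ f (mpoly.mmap_is_additive _ _))
            (GRing.isMonoidMorphism.Build _ _ f fM)
            (GRing.isScalable.Build _ _ _ _ f fZ).
by exists F => j; rewrite /F /= /f mpoly.mmapX mpoly.mmap1U.
Qed.

Lemma free_alg_generates n :
  generates (fun j : 'I_n => mkmalgU (fmu j) 1 : free_alg k n).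
Proof.
move=> P P1 PD PZ PX a.
have P0 : P 0 by rewrite -(scale0r 1); exact: PZ.
rewrite (monalgE a); elim/big_rec: _ => //= m b _ Pb; apply: PD => //.
have -> : mkmalgU m (monalg.mcoeff m a) =
    monalg.mcoeff m a *: mkmalgU m 1 :> free_alg k n.
  by apply/malgP => m'; rewrite monalg.mcoeffZ !monalg.mcoeffU mulr_natr.
apply: PZ; rewrite -[m]fmK; elim: (m : seq _) => [|j s IH].
  by rewrite -fmoneE.
have -> : monalg.FMonom (j :: s) = fmmul (fmu j) (monalg.FMonom s).
  by rewrite fmmulE fmU.
by have := PX j _ IH; rewrite /GRing.mul /= fgmulUU mul1r.
Qed.

Lemma free_alg_lift n (B : algType k) (v : 'I_n -> B) :
  exists f : {lrmorphism free_alg k n -> B},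
    forall j, f (mkmalgU (fmu j) 1) = v j.
Proof.
pose h (m : fmonom 'I_n) := \prod_(i <- m : seq 'I_n) v i.
have hM : mmorphism h.
  split=> [m m'|]; first by rewrite /h fmM big_cat.
  by rewrite /h fm1 big_nil.
pose H : MMorphism.type _ _ := HB.pack h (isMultiplicative.Build _ _ h hM).
pose f : free_alg k n -> B := monalg.mmap (in_alg B) H.
have fM : monoid_morphism f.
  have [] := @monalg.commr_mmap_is_multiplicative _ k B (in_alg B) H.
    by move=> a m m'; rewrite /GRing.comm mulr_algl mulr_algr.
    by split.
have fZ : scalable f by move=> c a; rewrite /f monalg.mmapZ mulr_algl.
pose F : {lrmorphism free_alg k n -> B} :=
  HB.pack f (GRing.isZmodMorphism.Build _ _ f (@monalg.mmap_is_additive _ _ _ _ _))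
            (GRing.isMonoidMorphism.Build _ _ f fM)
            (GRing.isScalable.Build _ _ _ _ f fZ).
exists F => j; rewrite /F /= /f monalg.mmapU.
by rewrite /= scale1r mul1r /h fmU big_seq1.
Qed.
End Generation.

(** * Morphisms out of a presented algebra *)

Section Quotient.
Variables (k : comNzRingType) (A : algType k) (rels : seq A).
Local Notation Q := (quot_alg rels).
Local Notation pi := (quot_pi rels).

Lemma quot_lift (B : algType k) (f : {lrmorphism A -> B}) :
  {in rels, forall r, f r = 0} ->
  exists g : {rmorphism Q -> B},
    (forall c u, g (c *: u) = c *: g u) /\ forall a, g (pi a) = f a.
Proof.
move=> f0; pose g (u : Q) := f (generic_quotient.repr u).
have gpi a : g (pi a) = f a.
  apply/esym/eqP; rewrite -subr_eq0 -raddfB; apply/eqP.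
  have [s sr ->] := quot_repr rels a; rewrite raddf_sum /=.
  by apply: big1_seq => t /andP[_ /sr tr]; rewrite !rmorphM /= (f0 _ tr) mulr0 mul0r.
have gB : zmod_morphism g.
  elim/quot_piW=> a; elim/quot_piW=> b.
  by rewrite -(raddfB (quot_pi rels)) !gpi raddfB.
have gM : monoid_morphism g.
  split; first by rewrite -(rmorph1 (quot_pi rels)) gpi rmorph1.
  elim/quot_piW=> a; elim/quot_piW=> b.
  by rewrite -(rmorphM (quot_pi rels)) !gpi rmorphM.
pose G : {rmorphism Q -> B} :=
  HB.pack g (GRing.isZmodMorphism.Build _ _ g gB)
            (GRing.isMonoidMorphism.Build _ _ g gM).
exists G; split=> // c; elim/quot_piW=> a.
have -> : c *: pi a = pi (c *: a) by rewrite linearZ.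
by rewrite /G /= !gpi linearZ.
Qed.

(** The composite [g \o f] is linear, fixes [1] and commutes with left multiplication by generators,
    hence is the identity by induction on words. Multiplicativity of [g] is not among the
    hypotheses, which allows [g] to be a sum of pieces supported on idempotents. *)
Lemma quot_iso (J : Type) (x : J -> A) (B : pzRingType) (sB : k -> B -> B)
    (f : {rmorphism Q -> B}) (g : B -> Q) :
  generates x -> (forall c u, f (c *: u) = sB c (f u)) ->
  {morph g : b b' / b + b'} -> (forall c b, g (sB c b) = c *: g b) -> g 1 = 1 ->
  (forall j b, g (f (pi (x j)) * b) = pi (x j) * g b) -> cancel g f ->
  alg_iso ( *:%R : k -> Q -> Q) sB.
Proof.
move=> xgen fZ gD gZ g1 gx gK; apply: (alg_iso_intro fZ _ gK).
elim/quot_piW; apply: xgen => [|a b Ea Eb|c a Ea|j a Ea].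
- by rewrite !rmorph1.
- by rewrite !raddfD /= gD Ea Eb.
- by rewrite linearZ /= fZ gZ Ea.
- by rewrite !rmorphM /= gx Ea.
Qed.

Lemma ga_lift (gT : finGroupType) (rho : gT -> Q) :
  rho 1%g = 1 -> (forall g h, rho (g * h)%g = rho g * rho h) ->
  exists f : {rmorphism group_alg k gT -> Q},
    (forall c b, f (c *: b) = c *: f b) /\ forall g, f (ga_of k g) = rho g.
Proof.
move=> rho1 rhoM.
pose f (b : group_alg k gT) : Q :=
  \sum_(g : gT) ((b : {ffun gT -> k^o}) g : k) *: rho g.
have fof g : f (ga_of k g) = rho g.
  rewrite /f (bigD1 g) //= big1 => [|h /negPf hg].
    by rewrite ffunE eqxx scale1r addr0.
  by rewrite ffunE hg scale0r.
have fB : zmod_morphism f.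
  move=> b b'; rewrite /f -sumrB; apply: eq_bigr => g _.
  by rewrite !ffunE -scalerBl.
have fZ c b : f (c *: b) = c *: f b.
  rewrite /f scaler_sumr; apply: eq_bigr => g _.
  by rewrite ffunE scalerA.
pose F1 : {additive group_alg k gT -> Q} :=
  HB.pack f (GRing.isZmodMorphism.Build _ _ f fB).
have fsum (c : gT -> group_alg k gT) : f (\sum_g c g) = \sum_g f (c g).
  exact: (raddf_sum F1).
have fM : monoid_morphism f.
  split; first by rewrite -rho1 -fof.
  move=> b b'; rewrite [in LHS](ga_of_expand b) [in LHS](ga_of_expand b').
  rewrite mulr_suml fsum [in RHS]/f mulr_suml; apply: eq_bigr => g _.
  rewrite mulr_sumr fsum mulr_sumr; apply: eq_bigr => h _ /=.
  rewrite -scalerAl -scalerAr -ga_ofM !fZ fof rhoM.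
  by rewrite -quot_scalerAl -quot_scalerAr.
pose F : {rmorphism group_alg k gT -> Q} :=
  HB.pack f (GRing.isZmodMorphism.Build _ _ f fB)
            (GRing.isMonoidMorphism.Build _ _ f fM).
by exists F.
Qed.

Lemma ga_liftK (gT : finGroupType) (f : {rmorphism Q -> group_alg k gT})
    (g : {rmorphism group_alg k gT -> Q}) :
  (forall c u, f (c *: u) = c *: f u) -> (forall c b, g (c *: b) = c *: g b) ->
  (forall h, f (g (ga_of k h)) = ga_of k h) -> cancel g f.
Proof.
move=> fZ gZ fg b; rewrite [in LHS](ga_of_expand b) [RHS](ga_of_expand b).
rewrite !raddf_sum /=; by apply: eq_bigr => h _; rewrite gZ fZ fg.
Qed.

End Quotient.

(** * Frobenius for commuting elements, and eigenspace projections *)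

Section Frobenius.
Variables (R : pzRingType) (p : nat).
Hypotheses (p_pr : prime p) (pR0 : p%:R = 0 :> R).

Lemma exprDp_comm (a b : R) : GRing.comm a b -> (a + b) ^+ p = a ^+ p + b ^+ p.
Proof.
move=> cab; rewrite exprDn_comm //; move: p_pr pR0; case: p => // q q_pr qR0.
rewrite big_ord_recr big_ord_recl /= subn0 subnn bin0 binn !expr0.
rewrite mulr1 mul1r !mulr1n big1 ?addr0 // => i _.
have /dvdnP[d ->] : (q.+1 %| 'C(q.+1, lift ord0 i))%N.
  by apply: prime_dvd_bin => //=; rewrite ltnS ltn_ord.
by rewrite mulrnA -mulr_natl qR0 mul0r.
Qed.

Lemma exprDpn_comm e (a b : R) :
  GRing.comm a b -> (a + b) ^+ (p ^ e) = a ^+ (p ^ e) + b ^+ (p ^ e).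
Proof.
move=> cab; elim: e => [|e IH]; first by rewrite !expr1.
rewrite expnSr !exprM IH exprDp_comm //.
exact: commrX (commr_sym (commrX _ (commr_sym cab))).
Qed.

Lemma expr1Dpn e (a : R) : a ^+ (p ^ e) = 0 -> (1 + a) ^+ (p ^ e) = 1.
Proof.
move=> a0; rewrite exprDpn_comm ?a0 ?expr1n ?addr0 //.
exact: commr_sym (commr1 _).
Qed.

Lemma expr_natp n : n%:R ^+ p = n%:R :> R.
Proof.
elim: n => [|n IH]; first by rewrite expr0n -(prednK (prime_gt0 p_pr)).
by rewrite -natr1 exprDp_comm ?IH ?expr1n //; exact: commr1.
Qed.

(* The projection onto the eigenspace of z for the eigenvalue i, if z ^+ p = z. *)
Definition eigen_idem (z : R) (i : nat) : R := 1 - (z - i%:R) ^+ p.-1.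

(** By Frobenius and Fermat, (z - i)^p = z^p - i^p = z - i, so z - i kills 1 - (z - i)^(p-1). *)
Lemma eigen_idem_mul (z : R) i :
  z ^+ p = z -> z * eigen_idem z i = i%:R * eigen_idem z i.
Proof.
move=> zp; apply/eqP; rewrite -subr_eq0 -mulrBl mulrBr mulr1 -exprS.
rewrite prednK ?prime_gt0 //; suff -> : (z - i%:R) ^+ p = z - i%:R by rewrite subrr.
have cz : GRing.comm (z - i%:R) i%:R by exact: commr_nat.
by have := exprDp_comm cz; rewrite subrK zp expr_natp => zE; rewrite [in RHS]zE addrK.
Qed.

Lemma comm_eigen_idem (a z : R) i : GRing.comm a z -> GRing.comm a (eigen_idem z i).
Proof.
move=> caz; apply: commrB; first exact: commr1.
by apply: commrX; apply: commrB => //; exact: commr_nat.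
Qed.

End Frobenius.

Lemma rmorph_eigen_idem p (R S : pzRingType) (f : {rmorphism R -> S}) z i :
  f (eigen_idem p z i) = eigen_idem p (f z) i.
Proof. by rewrite rmorphB rmorph1 rmorphXn rmorphB rmorph_nat. Qed.

(** * Idempotents in characteristic p *)

Section CharP.
Variables (k : fieldType) (p : nat).
Hypotheses (p_pr : prime p) (char_k : p \in [pchar k]).

Lemma quot_natp0 (A : algType k) (rels : seq A) : p%:R = 0 :> quot_alg rels.
Proof. by rewrite -scaler_nat (pcharf0 char_k) scale0r. Qed.

(** Fermat's little theorem in the prime field: i - j is fixed by Frobenius, and when nonzero it can
    be cancelled once. *)
Lemma expr_pred_natB (i j : 'I_p) :
  (i%:R - j%:R : k) ^+ p.-1 = (i != j)%:R.
Proof.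
have p0 := pcharf0 char_k.
have [->|ij] := eqVneq i j.
  by rewrite subrr expr0n; case: p p_pr => [|[|]].
set x := _ - _; have xp : x ^+ p = x.
  have := exprDp_comm p_pr p0 (mulrC x j%:R); rewrite subrK !expr_natp // => E.
  by rewrite [in RHS]/x E addrK.
suff x0 : x != 0.
  by apply: (mulfI x0); rewrite -exprS prednK ?prime_gt0 // mulr1.
(* Once [i <= j], the difference is a natural number below [p] that [p] divides, hence zero. *)
rewrite subr_eq0; apply: contra ij; wlog le_ij : i j {x xp} / (i <= j)%N.
  move=> H; case/orP: (leq_total i j) => ?; first exact: H.
  by rewrite eq_sym [i == _]eq_sym; exact: H.
rewrite eq_sym -subr_eq0 -natrB // -(dvdn_pcharf char_k) => /dvdnP[d E].
apply/eqP/val_inj => /=.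
have := ltn_ord j; rewrite -(subnK le_ij) E; case: d E => [|d] E; first by rewrite add0n.
by rewrite mulSn -addnA -[X in (_ < X)%N]addn0 ltn_add2l.
Qed.

Lemma eigen_idem_natr (B : algType k) (i j : 'I_p) :
  eigen_idem p (i%:R : B) j = (i == j)%:R.
Proof.
have -> : i%:R = in_alg B i%:R by rewrite rmorph_nat.
rewrite -rmorph_eigen_idem /eigen_idem expr_pred_natB -(rmorph_nat (in_alg B)).
by case: eqP; rewrite ?subr0 ?subrr.
Qed.

(** A polynomial identity, so it holds for every [z]: the sum minus 1 has degree below p and
    vanishes at the p distinct elements of F_p. *)
Lemma sum_eigen_idem (A : algType k) (z : A) : \sum_(i < p) eigen_idem p z i = 1.
Proof.
pose q : {poly k} := \sum_(i < p) eigen_idem p 'X i - 1.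
suff q0 : q = 0.
  have := congr1 (horner_alg z) q0; rewrite rmorphB rmorph1 rmorph0 rmorph_sum /=.
  under eq_bigr do rewrite rmorph_eigen_idem /= horner_algX.
  by move/eqP; rewrite subr_eq0 => /eqP.
pose rs := [seq (i%:R : k) | i : 'I_p].
apply: (@roots_geq_poly_eq0 _ q rs).
- apply/allP=> _ /mapP[j _ ->]; rewrite rootE.
  have -> : q.[j%:R] = horner_eval j%:R q by [].
  rewrite rmorphB rmorph1 rmorph_sum /= subr_eq0.
  under eq_bigr do rewrite rmorph_eigen_idem /= /horner_eval hornerX
    (eigen_idem_natr k^o).
  by rewrite (bigD1 j) //= eqxx big1 ?addr0 // => i /negPf; rewrite eq_sym => ->.
(* The roots are distinct: equal images of different [i] and [j] would give 0^(p-1) = 1 in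
   [expr_pred_natB]. *)
- rewrite map_inj_uniq ?enum_uniq // => i j E; apply/eqP; apply/negPn/negP=> ij.
  have := expr_pred_natB i j; rewrite ij E subrr expr0n => /esym/eqP.
  by case: p p_pr => [|[|]] //=; rewrite oner_eq0.
rewrite size_map size_enum_ord; have p0 := prime_gt0 p_pr.
apply: (leq_trans (size_polyD _ _)); rewrite size_polyN size_poly1 geq_max p0 andbT.
apply: (leq_trans (size_sum _ _ _)); apply/bigmax_leqP => i _.
apply: (leq_trans (size_polyD _ _)); rewrite size_polyN size_poly1 geq_max p0.
by rewrite -polyC_natr size_exp_XsubC prednK /=.
Qed.

Lemma quot_sum_eigen_idem (A : algType k) (rels : seq A) (z : A) :
  \sum_(i < p) eigen_idem p (quot_pi rels z) i = 1.
Proof.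
under eq_bigr do rewrite -rmorph_eigen_idem.
by rewrite -rmorph_sum /= sum_eigen_idem rmorph1.
Qed.

End CharP.

(** * Computing in algebras of products of cyclic groups *)

Section CyclicGroupAlgebra.

Lemma ga_mulC (k : comNzRingType) (gT : finGroupType) :
  (forall g h : gT, (g * h = h * g)%g) ->
  forall a b : group_alg k gT, a * b = b * a.
Proof.
move=> gC a b; rewrite (ga_of_expand a) (ga_of_expand b) !mulr_suml.
under eq_bigr do rewrite mulr_sumr; rewrite exchange_big; apply: eq_bigr => h _ /=.
rewrite mulr_sumr; apply: eq_bigr => g _.
by rewrite -!scalerAl -!scalerAr -!ga_ofM gC !scalerA mulrC.
Qed.

Lemma ga_ofX (k : comNzRingType) (gT : finGroupType) (g : gT) m :
  ga_of k (g ^+ m)%g = ga_of k g ^+ m.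
Proof. by elim: m => [|m IH]; rewrite ?expg0 ?expr0 // expgS ga_ofM IH exprS. Qed.

Lemma Zp_mulg_expr (R : pzRingType) n (u : R) (a b : 'Z_n) :
  (1 < n)%N -> u ^+ n = 1 -> u ^+ (a * b)%g = u ^+ a * u ^+ b.
Proof.
move=> n1 un; rewrite -exprD [in RHS](divn_eq (a + b) n) exprD mulnC exprM.
(* The group law of ['Z_n] is addition modulo [(Zp_trunc n).+2], which equals [n] because
   [1 < n]. *)
have valM m : m = (Zp_trunc n).+2 -> (a * b)%g = ((a + b) %% m)%N :> nat by move=> ->.
by rewrite un expr1n mul1r (valM n) // Zp_cast.
Qed.

Lemma Zp_mulgC n (a b : 'Z_n) : (a * b = b * a)%g.
Proof. exact: addrC. Qed.

Lemma pair_mulgC (gT hT : finGroupType) :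
  (forall g h : gT, (g * h = h * g)%g) -> (forall g h : hT, (g * h = h * g)%g) ->
  forall g h : (gT * hT)%type, (g * h = h * g)%g.
Proof. by move=> gC hC [g1 h1] [g2 h2]; congr pair. Qed.

Lemma pair_expg (gT hT : finGroupType) (g : gT) (h : hT) m :
  ((g, h) ^+ m = (g ^+ m, h ^+ m))%g.
Proof. by elim: m => // m IH; rewrite !expgS IH. Qed.

Lemma Zp1_expg n : (1 < n)%N -> ((Zp1 : 'Z_n) ^+ n = 1)%g.
Proof. by move=> n1; rewrite Zp_expg; apply/val_inj; rewrite /= Zp_cast // modnMl. Qed.

End CyclicGroupAlgebra.

(** * Maps between presented algebras and group algebras *)

Section GroupAlgebraLift.
Variables (k : comNzRingType) (A : algType k) (rels : seq A).
Local Notation Q := (quot_alg rels).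

Section Pair.
Variables (gT hT : finGroupType) (rho : gT -> Q) (sigma : hT -> Q).
Hypotheses (rho1 : rho 1%g = 1) (rhoM : forall g h, rho (g * h)%g = rho g * rho h).
Hypotheses (sigma1 : sigma 1%g = 1)
  (sigmaM : forall g h, sigma (g * h)%g = sigma g * sigma h).
Hypothesis rho_sigma : forall g h, GRing.comm (rho g) (sigma h).

Lemma pair_rep :
  let tau (x : gT * hT) := rho x.1 * sigma x.2 in
  tau 1%g = 1 /\ forall x y, tau (x * y)%g = tau x * tau y.
Proof.
split=> [|[g1 h1] [g2 h2]] /=; first by rewrite rho1 sigma1 mulr1.
by rewrite rhoM sigmaM -!mulrA; congr (_ * _); rewrite !mulrA rho_sigma.
Qed.
End Pair.

Lemma ga_lift1 n (u : Q) :
  (1 < n)%N -> u ^+ n = 1 ->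
  exists f : {rmorphism group_alg k 'Z_n -> Q},
    (forall c b, f (c *: b) = c *: f b) /\ f (ga_of k Zp1) = u.
Proof.
move=> n1 un; have uM a b := Zp_mulg_expr a b n1 un.
have [f [fZ fE]] := @ga_lift k A rels _ (fun a : 'Z_n => u ^+ a) (expr0 u) uM.
by exists f; split=> //; rewrite fE expr1.
Qed.

Lemma ga_lift2 m n (u v : Q) :
  (1 < m)%N -> (1 < n)%N -> u ^+ m = 1 -> v ^+ n = 1 -> GRing.comm u v ->
  exists f : {rmorphism group_alg k ('Z_m * 'Z_n)%type -> Q},
    [/\ forall c b, f (c *: b) = c *: f b,
        f (ga_of k (Zp1, 1%g)) = u & f (ga_of k (1%g, Zp1)) = v].
Proof.
move=> m1 n1 um vn uv.
have uM a b := Zp_mulg_expr a b m1 um; have vM a b := Zp_mulg_expr a b n1 vn.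
have uvX (a : 'Z_m) (b : 'Z_n) : GRing.comm (u ^+ a) (v ^+ b).
  exact/commrX/commr_sym/commrX/commr_sym.
have [rho1 rhoM] := pair_rep (expr0 u) uM (expr0 v) vM uvX.
have [f [fZ fE]] := ga_lift rho1 rhoM.
by exists f; split=> //; rewrite fE /= ?mulr1 ?mul1r.
Qed.

Lemma ga_lift3 l m n (u v w : Q) :
  (1 < l)%N -> (1 < m)%N -> (1 < n)%N -> u ^+ l = 1 -> v ^+ m = 1 -> w ^+ n = 1 ->
  GRing.comm u v -> GRing.comm u w -> GRing.comm v w ->
  exists f : {rmorphism group_alg k ('Z_l * 'Z_m * 'Z_n)%type -> Q},
    [/\ forall c b, f (c *: b) = c *: f b,
        f (ga_of k (Zp1, 1%g, 1%g)) = u, f (ga_of k (1%g, Zp1, 1%g)) = v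
      & f (ga_of k (1%g, 1%g, Zp1)) = w].
Proof.
move=> l1 m1 n1 ul vm wn uv uw vw.
have uM a b := Zp_mulg_expr a b l1 ul; have vM a b := Zp_mulg_expr a b m1 vm.
have wM a b := Zp_mulg_expr a b n1 wn.
have uvX (a : 'Z_l) (b : 'Z_m) : GRing.comm (u ^+ a) (v ^+ b).
  exact/commrX/commr_sym/commrX/commr_sym.
have [rho1 rhoM] := pair_rep (expr0 u) uM (expr0 v) vM uvX.
have uvwX (g : ('Z_l * 'Z_m)%type) (c : 'Z_n) :
    GRing.comm (u ^+ g.1 * v ^+ g.2) (w ^+ c).
  by apply/commrX/commr_sym/commrM; apply/commrX/commr_sym.
have [tau1 tauM] := pair_rep rho1 rhoM (expr0 w) wM uvwX.
have [f [fZ fE]] := ga_lift tau1 tauM.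
by exists f; split=> //; rewrite fE /= ?mulr1 ?mul1r.
Qed.

Section Cancel.
Variable gT : finGroupType.
Variables (f : {rmorphism Q -> group_alg k gT}) (g : {rmorphism group_alg k gT -> Q}).

Lemma ga_fixX h m : f (g (ga_of k h)) = ga_of k h ->
  f (g (ga_of k (h ^+ m)%g)) = ga_of k (h ^+ m)%g.
Proof. by move=> fgh; rewrite ga_ofX !rmorphXn /= fgh. Qed.

Lemma ga_fixM h h' :
  f (g (ga_of k h)) = ga_of k h -> f (g (ga_of k h')) = ga_of k h' ->
  f (g (ga_of k (h * h')%g)) = ga_of k (h * h')%g.
Proof. by move=> fgh fgh'; rewrite ga_ofM !rmorphM /= fgh fgh'. Qed.
End Cancel.

Lemma ga_liftK1 n (f : {rmorphism Q -> group_alg k 'Z_n})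
    (g : {rmorphism group_alg k 'Z_n -> Q}) :
  (forall c u, f (c *: u) = c *: f u) -> (forall c b, g (c *: b) = c *: g b) ->
  f (g (ga_of k Zp1)) = ga_of k Zp1 -> cancel g f.
Proof.
move=> fZ gZ fg; apply: ga_liftK => // h.
by rewrite -(Zp1_expgz h); exact: ga_fixX.
Qed.

Lemma ga_liftK2 m n (f : {rmorphism Q -> group_alg k ('Z_m * 'Z_n)%type})
    (g : {rmorphism group_alg k ('Z_m * 'Z_n)%type -> Q}) :
  (forall c u, f (c *: u) = c *: f u) -> (forall c b, g (c *: b) = c *: g b) ->
  f (g (ga_of k (Zp1, 1%g))) = ga_of k (Zp1, 1%g) ->
  f (g (ga_of k (1%g, Zp1))) = ga_of k (1%g, Zp1) -> cancel g f.
Proof.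
move=> fZ gZ fg1 fg2; apply: ga_liftK => // -[a b].
have -> : (a, b) = ((Zp1, 1) ^+ a * (1, Zp1) ^+ b)%g.
  by rewrite !pair_expg !expg1n !Zp1_expgz; congr pair; rewrite ?mulg1 ?mul1g.
by apply: ga_fixM; exact: ga_fixX.
Qed.

Lemma ga_liftK3 l m n (f : {rmorphism Q -> group_alg k ('Z_l * 'Z_m * 'Z_n)%type})
    (g : {rmorphism group_alg k ('Z_l * 'Z_m * 'Z_n)%type -> Q}) :
  (forall c u, f (c *: u) = c *: f u) -> (forall c b, g (c *: b) = c *: g b) ->
  f (g (ga_of k (Zp1, 1%g, 1%g))) = ga_of k (Zp1, 1%g, 1%g) ->
  f (g (ga_of k (1%g, Zp1, 1%g))) = ga_of k (1%g, Zp1, 1%g) ->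
  f (g (ga_of k (1%g, 1%g, Zp1))) = ga_of k (1%g, 1%g, Zp1) -> cancel g f.
Proof.
move=> fZ gZ fg1 fg2 fg3; apply: ga_liftK => // -[[a b] c].
have -> : (a, b, c) = ((Zp1, 1, 1) ^+ a * (1, Zp1, 1) ^+ b * (1, 1, Zp1) ^+ c)%g.
  rewrite !pair_expg !expg1n !Zp1_expgz.
  by apply: (congr2 pair (congr2 pair _ _) _); rewrite /= ?mulg1 ?mul1g ?mulg1.
by do 2?apply: ga_fixM; exact: ga_fixX.
Qed.

Lemma quot_rel0 r : r \in rels -> quot_pi rels r = 0.
Proof. by move=> ?; apply/quot_pi_eq0P; exact: in_ideal_rel. Qed.

Lemma quot_relB a b : a - b \in rels -> quot_pi rels a = quot_pi rels b.
Proof. by move=> ?; apply/quot_eqP; exact: in_ideal_rel. Qed.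

Lemma quot_iso_ga (J : Type) (x : J -> A) (gT : finGroupType)
    (f : {rmorphism Q -> group_alg k gT}) (g : {rmorphism group_alg k gT -> Q}) :
  generates x ->
  (forall c u, f (c *: u) = c *: f u) -> (forall c b, g (c *: b) = c *: g b) ->
  (forall j, g (f (quot_pi rels (x j))) = quot_pi rels (x j)) -> cancel g f ->
  Q =~[k] group_alg k gT.
Proof.
move=> xgen fZ gZ gx gK; apply: (quot_iso xgen fZ) gK => //.
- exact: raddfD.
- exact: rmorph1.
- by move=> j b; rewrite rmorphM gx.
Qed.

(** The inverse sends a family b to the sum of the [e i * g (b i)]: on the piece cut out by [e i],
    [g] undoes [f i] on generators. The Kronecker values of [f i (e i')] separate the factors
    again. *)
Lemma quot_iso_ffun_ga (J : Type) (x : J -> A) (gT : finGroupType) (I : finType)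
    (f : I -> {rmorphism Q -> group_alg k gT}) (g : {rmorphism group_alg k gT -> Q})
    (e : I -> Q) :
  generates x ->
  (forall i c u, f i (c *: u) = c *: f i u) ->
  (forall c b, g (c *: b) = c *: g b) ->
  (forall i, cancel g (f i)) ->
  \sum_i e i = 1 ->
  (forall i j, GRing.comm (quot_pi rels (x j)) (e i)) ->
  (forall i j, e i * g (f i (quot_pi rels (x j))) = e i * quot_pi rels (x j)) ->
  (forall i i', f i (e i') = (i == i')%:R) ->
  Q =~[k] {ffun I -> group_alg k gT}.
Proof.
move=> xgen fZ gZ gK esum ecomm egf fe; have [F FE] := ffun_rmorphism f.
pose G (b : {ffun I -> group_alg k gT}) := \sum_i e i * g (b i).
apply: (@quot_iso _ _ _ _ _ _ _ F G xgen).
- by move=> c u; apply/ffunP=> i; rewrite !(FE, ffunE) fZ.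
- move=> b b'; rewrite /G -big_split; apply: eq_bigr => i _ /=.
  by rewrite ffunE rmorphD mulrDr.
- move=> c b; rewrite /G scaler_sumr; apply: eq_bigr => i _.
  by rewrite ffunE gZ -quot_scalerAr.
- by rewrite /G -[RHS]esum; apply: eq_bigr => i _; rewrite ffunE rmorph1 mulr1.
- move=> j b; rewrite /G mulr_sumr; apply: eq_bigr => i _.
  by rewrite !(FE, ffunE) rmorphM [LHS]mulrA egf -ecomm mulrA.
- move=> b; rewrite FE; apply/ffunP=> i; rewrite ffunE rmorph_sum (bigD1 i) //= big1.
    by rewrite rmorphM fe eqxx mul1r gK addr0.
  by move=> i' /negPf; rewrite rmorphM fe eq_sym => ->; rewrite mul0r.
Qed.

End GroupAlgebraLift.

Lemma expr_pn_subr1 p e (R : pzRingType) (u : R) :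
  prime p -> p%:R = 0 :> R -> u ^+ (p ^ e) = 1 -> (u - 1) ^+ (p ^ e) = 0.
Proof.
move=> p_pr p0 u1; have := exprDpn_comm p_pr p0 e (commr_sym (commr1 (u - 1))).
by rewrite addrC subrK u1 expr1n => /eqP; rewrite addrC eq_sym -subr_eq0 addrK => /eqP.
Qed.

Lemma ord3_ind (P : 'I_3 -> Prop) :
  P (@Ordinal 3 0 isT) -> P (@Ordinal 3 1 isT) -> P (@Ordinal 3 2 isT) ->
  forall j, P j.
Proof.
by move=> P0 P1 P2 [[|[|[|j]]] j3] //; rewrite (bool_irrelevance j3 isT).
Qed.

(** * Commutative presentations *)

Lemma in_seq3 (T : eqType) (P : T -> Prop) (a b c : T) :
  P a -> P b -> P c -> {in [:: a; b; c], forall r, P r}.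
Proof. by move=> Pa Pb Pc r; rewrite !inE => /or3P[]/eqP->. Qed.

Lemma rmorphXn_eq0 (k : comNzRingType) (A B : algType k)
    (f : {lrmorphism A -> B}) a n :
  f a ^+ n = 0 -> f (a ^+ n) = 0.
Proof. by rewrite rmorphXn. Qed.

Lemma rmorphXnB_eq0 (k : comNzRingType) (A B : algType k)
    (f : {lrmorphism A -> B}) a b n :
  f a ^+ n = f b -> f (a ^+ n - b) = 0.
Proof. by rewrite rmorphB rmorphXn => ->; rewrite subrr. Qed.

Section CommutativePresentations.
Variables (k : fieldType) (p : nat).
Hypotheses (p_pr : prime p) (char_k : p \in [pchar k]).

Local Notation x := (mpolyX k (mnm1 (@Ordinal 3 0 isT))).
Local Notation y := (mpolyX k (mnm1 (@Ordinal 3 1 isT))).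
Local Notation z := (mpolyX k (mnm1 (@Ordinal 3 2 isT))).

Let p1 := prime_gt1 p_pr.

Let pn_gt1 e : (1 < p ^ e.+1)%N.
Proof. by apply: leq_trans p1 _; rewrite expnS leq_pmulr // expn_gt0 prime_gt0. Qed.

Let p2E : (p * p = p ^ 2)%N.
Proof. by rewrite mulnn. Qed.

Let p3E : (p * p * p = p ^ 3)%N.
Proof. by rewrite p2E -expnSr. Qed.

Lemma ga_natp0 (gT : finGroupType) : p%:R = 0 :> group_alg k gT.
Proof. by rewrite -scaler_nat (pcharf0 char_k) scale0r. Qed.

Lemma ga_subr1_pn (gT : finGroupType) e (g : gT) :
  (g ^+ (p ^ e) = 1)%g -> (ga_of k g - 1) ^+ (p ^ e) = 0.
Proof. by move=> g1; apply: expr_pn_subr1 (ga_natp0 _) _ => //; rewrite -ga_ofX g1. Qed.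

Lemma ga_subr1_p (gT : finGroupType) (g : gT) :
  (g ^+ p = 1)%g -> (ga_of k g - 1) ^+ p = 0.
Proof. by rewrite -[p]expn1; exact: ga_subr1_pn. Qed.

(** The relations are checked on an arbitrary lift [F] known by its values on the generators, since
    [mpoly_lift] only asserts that a lift exists. *)
Lemma mpoly_quot_lift (rels : seq (mpoly 3 k)) (gT : finGroupType)
    (a b c : group_alg k gT) :
  (forall g h : gT, (g * h = h * g)%g) ->
  (forall F : {lrmorphism mpoly 3 k -> group_alg k gT},
     F x = a -> F y = b -> F z = c -> {in rels, forall r, F r = 0}) ->
  exists f : {rmorphism quot_alg rels -> group_alg k gT},
    [/\ forall d u, f (d *: u) = d *: f u, f (quot_pi rels x) = a,
        f (quot_pi rels y) = b & f (quot_pi rels z) = c].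
Proof.
move=> gC F0; have [|F FX] := @mpoly_lift k 3 _ (fun j : 'I_3 => nth 0 [:: a; b; c] j).
  by move=> j d; exact: ga_mulC.
have [|f [fZ fpi]] := @quot_lift _ _ rels _ F; first by apply: F0; rewrite FX.
by exists f; rewrite !fpi !FX.
Qed.

Lemma mpoly_quotC (rels : seq (mpoly 3 k)) (u v : quot_alg rels) : u * v = v * u.
Proof.
elim/quot_piW: u => a; elim/quot_piW: v => b.
by rewrite -!(rmorphM (quot_pi rels)) mulrC.
Qed.

(** Here y = z^p and x = z^(p^2), so only z remains, with z^(p^3) = 0; it corresponds to t = g - 1
    for the generator g. *)
Lemma A2_iso : A2 k p =~[k] group_alg k 'Z_(p ^ 3).
Proof.
rewrite /A2; set rels := [:: _; _; _]; pose pi := quot_pi rels.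
have rx : pi x ^+ p = 0 by rewrite -rmorphXn; apply: quot_rel0; rewrite !inE eqxx ?orbT.
have ry : pi y ^+ p = pi x.
  by rewrite -rmorphXn; apply: quot_relB; rewrite !inE eqxx ?orbT.
have rz : pi z ^+ p = pi y.
  by rewrite -rmorphXn; apply: quot_relB; rewrite !inE eqxx ?orbT.
have t0 := ga_subr1_pn (Zp1_expg (pn_gt1 2)); set t := _ - 1 in t0.
have [|F F0 F1 F2|f [fZ fx fy fz]] := @mpoly_quot_lift rels _ (t ^+ p ^+ p) (t ^+ p) t.
- exact: Zp_mulgC.
- apply: in_seq3.
  + by apply: rmorphXn_eq0; rewrite F0 -!exprM p3E.
  + by apply: rmorphXnB_eq0; rewrite F1 F0.
  + by apply: rmorphXnB_eq0; rewrite F2 F1.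
have p0 := quot_natp0 char_k rels.
have [|g [gZ g1]] := @ga_lift1 _ _ rels (p ^ 3) (1 + pi z) (pn_gt1 2).
  by apply: expr1Dpn => //; rewrite -p3E !exprM rz ry rx.
have gt : g t = pi z by rewrite rmorphB rmorph1 /= g1 addrC addKr.
apply: (quot_iso_ga (@mpoly_generates k 3) fZ gZ).
  by apply: ord3_ind; rewrite ?(fx, fy, fz) ?rmorphXn /= gt ?rz ?ry.
apply: ga_liftK1 => //.
by rewrite g1 rmorphD rmorph1 /= fz addrC subrK.
Qed.

(** The chain of p-th powers runs the other way: x is the surviving generator. *)
Lemma C2_iso : C2 k p =~[k] group_alg k 'Z_(p ^ 3).
Proof.
rewrite /C2; set rels := [:: _; _; _]; pose pi := quot_pi rels.
have rx : pi x ^+ p = pi y.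
  by rewrite -rmorphXn; apply: quot_relB; rewrite !inE eqxx ?orbT.
have ry : pi y ^+ p = pi z.
  by rewrite -rmorphXn; apply: quot_relB; rewrite !inE eqxx ?orbT.
have rz : pi z ^+ p = 0 by rewrite -rmorphXn; apply: quot_rel0; rewrite !inE eqxx ?orbT.
have t0 := ga_subr1_pn (Zp1_expg (pn_gt1 2)); set t := _ - 1 in t0.
have [|F F0 F1 F2|f [fZ fx fy fz]] := @mpoly_quot_lift rels _ t (t ^+ p) (t ^+ p ^+ p).
- exact: Zp_mulgC.
- apply: in_seq3.
  + by apply: rmorphXnB_eq0; rewrite F0 F1.
  + by apply: rmorphXnB_eq0; rewrite F1 F2.
  + by apply: rmorphXn_eq0; rewrite F2 -!exprM p3E.
have p0 := quot_natp0 char_k rels.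
have [|g [gZ g1]] := @ga_lift1 _ _ rels (p ^ 3) (1 + pi x) (pn_gt1 2).
  by apply: expr1Dpn => //; rewrite -p3E !exprM rx ry rz.
have gt : g t = pi x by rewrite rmorphB rmorph1 /= g1 addrC addKr.
apply: (quot_iso_ga (@mpoly_generates k 3) fZ gZ).
  by apply: ord3_ind; rewrite ?(fx, fy, fz) ?rmorphXn /= gt ?rx ?ry.
apply: ga_liftK1 => //.
by rewrite g1 rmorphD rmorph1 /= fx addrC subrK.
Qed.

Lemma A3_iso : A3 k p =~[k] group_alg k ('Z_p * 'Z_p * 'Z_p)%type.
Proof.
rewrite /A3; set rels := [:: _; _; _]; pose pi := quot_pi rels.
have rx : pi x ^+ p = 0 by rewrite -rmorphXn; apply: quot_rel0; rewrite !inE eqxx ?orbT.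
have ry : pi y ^+ p = 0 by rewrite -rmorphXn; apply: quot_rel0; rewrite !inE eqxx ?orbT.
have rz : pi z ^+ p = 0 by rewrite -rmorphXn; apply: quot_rel0; rewrite !inE eqxx ?orbT.
pose r := ga_of k ((Zp1, 1, 1)%g : 'Z_p * 'Z_p * 'Z_p) - 1.
pose s := ga_of k ((1, Zp1, 1)%g : 'Z_p * 'Z_p * 'Z_p) - 1.
pose t := ga_of k ((1, 1, Zp1)%g : 'Z_p * 'Z_p * 'Z_p) - 1.
have r0 : r ^+ p = 0 by apply: ga_subr1_p; rewrite !pair_expg Zp1_expg // !expg1n.
have s0 : s ^+ p = 0 by apply: ga_subr1_p; rewrite !pair_expg Zp1_expg // !expg1n.
have t0 : t ^+ p = 0 by apply: ga_subr1_p; rewrite !pair_expg Zp1_expg // !expg1n.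
have [|F F0 F1 F2|f [fZ fx fy fz]] := @mpoly_quot_lift rels _ r s t.
- by apply: pair_mulgC; [apply: pair_mulgC|]; exact: Zp_mulgC.
- apply: in_seq3.
  + by apply: rmorphXn_eq0; rewrite F0 r0.
  + by apply: rmorphXn_eq0; rewrite F1 s0.
  + by apply: rmorphXn_eq0; rewrite F2 t0.
have p0 := quot_natp0 char_k rels.
have u1 u : u ^+ p = 0 -> (1 + u : quot_alg rels) ^+ p = 1.
  by rewrite -{1 2}[p]expn1; exact: expr1Dpn.
have [g [gZ g1 g2 g3]] := @ga_lift3 _ _ rels _ _ _ _ _ _ p1 p1 p1
  (u1 _ rx) (u1 _ ry) (u1 _ rz) (mpoly_quotC _ _) (mpoly_quotC _ _) (mpoly_quotC _ _).
have gr : g r = pi x by rewrite rmorphB rmorph1 /= g1 addrC addKr.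
have gs : g s = pi y by rewrite rmorphB rmorph1 /= g2 addrC addKr.
have gt : g t = pi z by rewrite rmorphB rmorph1 /= g3 addrC addKr.
apply: (quot_iso_ga (@mpoly_generates k 3) fZ gZ).
  by apply: ord3_ind; rewrite ?(fx, fy, fz).
by apply: ga_liftK3 => //;
  rewrite ?(g1, g2, g3) rmorphD rmorph1 /= ?(fx, fy, fz) addrC subrK.
Qed.

(** The generator x = z^p is redundant; y has height p and z has height p^2. *)
Lemma A4_iso : A4 k p =~[k] group_alg k ('Z_p * 'Z_(p ^ 2))%type.
Proof.
rewrite /A4; set rels := [:: _; _; _]; pose pi := quot_pi rels.
have rx : pi x ^+ p = 0 by rewrite -rmorphXn; apply: quot_rel0; rewrite !inE eqxx ?orbT.
have ry : pi y ^+ p = 0 by rewrite -rmorphXn; apply: quot_rel0; rewrite !inE eqxx ?orbT.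
have rz : pi z ^+ p = pi x.
  by rewrite -rmorphXn; apply: quot_relB; rewrite !inE eqxx ?orbT.
pose s := ga_of k ((Zp1, 1)%g : 'Z_p * 'Z_(p ^ 2)) - 1.
pose t := ga_of k ((1, Zp1)%g : 'Z_p * 'Z_(p ^ 2)) - 1.
have s0 : s ^+ p = 0 by apply: ga_subr1_p; rewrite pair_expg Zp1_expg // expg1n.
have t0 : t ^+ (p ^ 2) = 0.
  by apply: ga_subr1_pn; rewrite pair_expg Zp1_expg ?expg1n.
have [|F F0 F1 F2|f [fZ fx fy fz]] := @mpoly_quot_lift rels _ (t ^+ p) s t.
- by apply: pair_mulgC; exact: Zp_mulgC.
- apply: in_seq3.
  + by apply: rmorphXn_eq0; rewrite F0 -!exprM p2E.
  + by apply: rmorphXn_eq0; rewrite F1.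
  + by apply: rmorphXnB_eq0; rewrite F2 F0.
have p0 := quot_natp0 char_k rels.
have [|||g [gZ g1 g2]] :=
  @ga_lift2 _ _ rels p (p ^ 2) (1 + pi y) (1 + pi z) p1 (pn_gt1 1).
- by rewrite -[X in _ ^+ X]expn1; apply: expr1Dpn.
- by apply: expr1Dpn => //; rewrite -p2E !exprM rz rx.
- exact: mpoly_quotC.
have gs : g s = pi y by rewrite rmorphB rmorph1 /= g1 addrC addKr.
have gt : g t = pi z by rewrite rmorphB rmorph1 /= g2 addrC addKr.
apply: (quot_iso_ga (@mpoly_generates k 3) fZ gZ).
  by apply: ord3_ind; rewrite ?(fx, fy, fz) ?rmorphXn /= ?(gs, gt).
by apply: ga_liftK2 => //; rewrite ?(g1, g2) rmorphD rmorph1 /= ?(fy, fz) addrC subrK.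
Qed.

(** Now z = y^p is redundant; x has height p and y has height p^2. *)
Lemma C3_iso : C3 k p =~[k] group_alg k ('Z_p * 'Z_(p ^ 2))%type.
Proof.
rewrite /C3; set rels := [:: _; _; _]; pose pi := quot_pi rels.
have rx : pi x ^+ p = 0 by rewrite -rmorphXn; apply: quot_rel0; rewrite !inE eqxx ?orbT.
have ry : pi y ^+ p = pi z.
  by rewrite -rmorphXn; apply: quot_relB; rewrite !inE eqxx ?orbT.
have rz : pi z ^+ p = 0 by rewrite -rmorphXn; apply: quot_rel0; rewrite !inE eqxx ?orbT.
pose s := ga_of k ((Zp1, 1)%g : 'Z_p * 'Z_(p ^ 2)) - 1.
pose t := ga_of k ((1, Zp1)%g : 'Z_p * 'Z_(p ^ 2)) - 1.
have s0 : s ^+ p = 0 by apply: ga_subr1_p; rewrite pair_expg Zp1_expg // expg1n.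
have t0 : t ^+ (p ^ 2) = 0.
  by apply: ga_subr1_pn; rewrite pair_expg Zp1_expg ?expg1n.
have [|F F0 F1 F2|f [fZ fx fy fz]] := @mpoly_quot_lift rels _ s t (t ^+ p).
- by apply: pair_mulgC; exact: Zp_mulgC.
- apply: in_seq3.
  + by apply: rmorphXn_eq0; rewrite F0.
  + by apply: rmorphXnB_eq0; rewrite F1 F2.
  + by apply: rmorphXn_eq0; rewrite F2 -!exprM p2E.
have p0 := quot_natp0 char_k rels.
have [|||g [gZ g1 g2]] :=
  @ga_lift2 _ _ rels p (p ^ 2) (1 + pi x) (1 + pi y) p1 (pn_gt1 1).
- by rewrite -[X in _ ^+ X]expn1; apply: expr1Dpn.
- by apply: expr1Dpn => //; rewrite -p2E !exprM ry rz.
- exact: mpoly_quotC.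
have gs : g s = pi x by rewrite rmorphB rmorph1 /= g1 addrC addKr.
have gt : g t = pi y by rewrite rmorphB rmorph1 /= g2 addrC addKr.
apply: (quot_iso_ga (@mpoly_generates k 3) fZ gZ).
  by apply: ord3_ind; rewrite ?(fx, fy, fz) ?rmorphXn /= ?(gs, gt) ?ry.
by apply: ga_liftK2 => //; rewrite ?(g1, g2) rmorphD rmorph1 /= ?(fx, fy) addrC subrK.
Qed.

End CommutativePresentations.

(** * Presentations split by relations of the form z^p = z *)

Section SemisimplePresentations.
Variables (k : fieldType) (p : nat).
Hypotheses (p_pr : prime p) (char_k : p \in [pchar k]).

Local Notation x := (mpolyX k (mnm1 (@Ordinal 3 0 isT))).
Local Notation y := (mpolyX k (mnm1 (@Ordinal 3 1 isT))).
Local Notation z := (mpolyX k (mnm1 (@Ordinal 3 2 isT))).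

Let p1 := prime_gt1 p_pr.

Let p2_gt1 : (1 < p ^ 2)%N.
Proof. by rewrite (leq_trans p1) // leq_pmulr // prime_gt0. Qed.

Let p2E : (p * p = p ^ 2)%N.
Proof. by rewrite mulnn. Qed.

(** Sending z to [i%:R] respects z^p = z by Fermat; this yields one map per [i], all with the same
    values on x and y, so a single [g] serves every factor. *)
Lemma C7_iso : C7 k p =~[k] {ffun 'I_p -> group_alg k ('Z_p * 'Z_p)%type}.
Proof.
rewrite /C7; set rels := [:: _; _; _]; pose pi := quot_pi rels.
have rx : pi x ^+ p = 0 by rewrite -rmorphXn; apply: quot_rel0; rewrite !inE eqxx ?orbT.
have ry : pi y ^+ p = 0 by rewrite -rmorphXn; apply: quot_rel0; rewrite !inE eqxx ?orbT.
have rz : pi z ^+ p = pi z.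
  by rewrite -rmorphXn; apply: quot_relB; rewrite !inE eqxx ?orbT.
pose s := ga_of k ((Zp1, 1)%g : 'Z_p * 'Z_p) - 1.
pose t := ga_of k ((1, Zp1)%g : 'Z_p * 'Z_p) - 1.
have s0 : s ^+ p = 0 by apply: ga_subr1_p; rewrite // pair_expg Zp1_expg // expg1n.
have t0 : t ^+ p = 0 by apply: ga_subr1_p; rewrite // pair_expg Zp1_expg // expg1n.
have /fin_all_exists[f fP] (i : 'I_p) : exists f : {rmorphism quot_alg rels -> _},
    [/\ forall d u, f (d *: u) = d *: f u, f (pi x) = s, f (pi y) = t
      & f (pi z) = i%:R].
  apply: mpoly_quot_lift; first by apply: pair_mulgC; exact: Zp_mulgC.
  move=> F F0 F1 F2; apply: in_seq3.
  - by apply: rmorphXn_eq0; rewrite F0 s0.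
  - by apply: rmorphXn_eq0; rewrite F1 t0.
  - by apply: rmorphXnB_eq0; rewrite F2 expr_natp // ga_natp0.
have p0 := quot_natp0 char_k rels.
have u1 u : u ^+ p = 0 -> (1 + u : quot_alg rels) ^+ p = 1.
  by rewrite -{1 2}[p]expn1; exact: expr1Dpn.
have [g [gZ g1 g2]] := @ga_lift2 _ _ rels _ _ _ _ p1 p1
  (u1 _ rx) (u1 _ ry) (mpoly_quotC _ _).
have gs : g s = pi x by rewrite rmorphB rmorph1 /= g1 addrC addKr.
have gt : g t = pi y by rewrite rmorphB rmorph1 /= g2 addrC addKr.
apply: (quot_iso_ffun_ga (f := f) (g := g) (e := fun i : 'I_p => eigen_idem p (pi z) i)
  (@mpoly_generates k 3)) => //.
- by move=> i; have [] := fP i.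
- move=> i; have [fZ fx fy fz] := fP i.
  by apply: ga_liftK2 => //; rewrite ?(g1, g2) rmorphD rmorph1 /= ?(fx, fy) addrC subrK.
- exact: quot_sum_eigen_idem.
- by move=> i j; exact: mpoly_quotC.
- move=> i; have [fZ fx fy fz] := fP i.
  apply: ord3_ind; rewrite ?(fx, fy, fz) ?(gs, gt) //.
  rewrite rmorph_nat [LHS]mpoly_quotC [RHS]mpoly_quotC.
  exact/esym/eigen_idem_mul.
- move=> i i'; have [fZ fx fy fz] := fP i.
  by rewrite rmorph_eigen_idem fz (eigen_idem_natr p_pr char_k).
Qed.

Lemma C8_iso : C8 k p =~[k] {ffun 'I_p -> group_alg k 'Z_(p ^ 2)}.
Proof.
rewrite /C8; set rels := [:: _; _; _]; pose pi := quot_pi rels.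
have rx : pi x ^+ p = pi y.
  by rewrite -rmorphXn; apply: quot_relB; rewrite !inE eqxx ?orbT.
have ry : pi y ^+ p = 0 by rewrite -rmorphXn; apply: quot_rel0; rewrite !inE eqxx ?orbT.
have rz : pi z ^+ p = pi z.
  by rewrite -rmorphXn; apply: quot_relB; rewrite !inE eqxx ?orbT.
have t0 := ga_subr1_pn p_pr char_k (Zp1_expg p2_gt1); set t := _ - 1 in t0.
have /fin_all_exists[f fP] (i : 'I_p) : exists f : {rmorphism quot_alg rels -> _},
    [/\ forall d u, f (d *: u) = d *: f u, f (pi x) = t, f (pi y) = t ^+ p
      & f (pi z) = i%:R].
  apply: mpoly_quot_lift; first exact: Zp_mulgC.
  move=> F F0 F1 F2; apply: in_seq3.
  - by apply: rmorphXnB_eq0; rewrite F0 F1.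
  - by apply: rmorphXn_eq0; rewrite F1 -!exprM p2E.
  - by apply: rmorphXnB_eq0; rewrite F2 expr_natp // ga_natp0.
have p0 := quot_natp0 char_k rels.
have [|g [gZ g1]] := @ga_lift1 _ _ rels (p ^ 2) (1 + pi x) p2_gt1.
  by apply: expr1Dpn => //; rewrite -p2E exprM rx ry.
have gt : g t = pi x by rewrite rmorphB rmorph1 /= g1 addrC addKr.
apply: (quot_iso_ffun_ga (f := f) (g := g) (e := fun i : 'I_p => eigen_idem p (pi z) i)
  (@mpoly_generates k 3)) => //.
- by move=> i; have [] := fP i.
- move=> i; have [fZ fx fy fz] := fP i.
  by apply: ga_liftK1 => //; rewrite g1 rmorphD rmorph1 /= fx addrC subrK.
- exact: quot_sum_eigen_idem.
- by move=> i j; exact: mpoly_quotC.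
- move=> i; have [fZ fx fy fz] := fP i.
  apply: ord3_ind; rewrite ?(fx, fy, fz) ?rmorphXn /= ?gt ?rx //.
  rewrite rmorph_nat [LHS]mpoly_quotC [RHS]mpoly_quotC.
  exact/esym/eigen_idem_mul.
- move=> i i'; have [fZ fx fy fz] := fP i.
  by rewrite rmorph_eigen_idem fz (eigen_idem_natr p_pr char_k).
Qed.

(** Both y and z have eigenvalues in F_p, so the factors are indexed by pairs and their idempotents
    are products of one for y and one for z. *)
Lemma C9_iso : C9 k p =~[k] {ffun 'I_(p ^ 2) -> group_alg k 'Z_p}.
Proof.
suff iso : C9 k p =~[k] {ffun 'I_p * 'I_p -> group_alg k 'Z_p}.
  apply: alg_iso_trans iso _; apply: alg_iso_sym.
  (* [mxvec_index] numbers the entries of a p by p matrix, which flattens pairs into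
     ['I_(p * p)]. *)
  rewrite -p2E; apply: (@ffun_alg_iso_reindex _ _ _ _ (uncurry (@mxvec_index p p))).
  have [h hK h'K] := curry_mxvec_bij p p.
  by exists h => [u|u]; [exact: hK | exact: h'K].
rewrite /C9; set rels := [:: _; _; _]; pose pi := quot_pi rels.
have rx : pi x ^+ p = 0 by rewrite -rmorphXn; apply: quot_rel0; rewrite !inE eqxx ?orbT.
have ry : pi y ^+ p = pi y.
  by rewrite -rmorphXn; apply: quot_relB; rewrite !inE eqxx ?orbT.
have rz : pi z ^+ p = pi z.
  by rewrite -rmorphXn; apply: quot_relB; rewrite !inE eqxx ?orbT.
have t0 := ga_subr1_p p_pr char_k (Zp1_expg p1); set t := _ - 1 in t0.
have /fin_all_exists[f fP] (i : 'I_p * 'I_p) :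
    exists f : {rmorphism quot_alg rels -> _},
    [/\ forall d u, f (d *: u) = d *: f u, f (pi x) = t, f (pi y) = i.1%:R
      & f (pi z) = i.2%:R].
  apply: mpoly_quot_lift; first exact: Zp_mulgC.
  move=> F F0 F1 F2; apply: in_seq3.
  - by apply: rmorphXn_eq0; rewrite F0.
  - by apply: rmorphXnB_eq0; rewrite F1 expr_natp // ga_natp0.
  - by apply: rmorphXnB_eq0; rewrite F2 expr_natp // ga_natp0.
have p0 := quot_natp0 char_k rels.
have u1 u : u ^+ p = 0 -> (1 + u : quot_alg rels) ^+ p = 1.
  by rewrite -{1 2}[p]expn1; exact: expr1Dpn.
have [g [gZ g1]] := @ga_lift1 _ _ rels _ _ p1 (u1 _ rx).
have gt : g t = pi x by rewrite rmorphB rmorph1 /= g1 addrC addKr.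
pose e (i : 'I_p * 'I_p) := eigen_idem p (pi y) i.1 * eigen_idem p (pi z) i.2.
apply: (quot_iso_ffun_ga (f := f) (g := g) (e := e) (@mpoly_generates k 3)) => //.
- by move=> i; have [] := fP i.
- move=> i; have [fZ fx fy fz] := fP i.
  by apply: ga_liftK1 => //; rewrite g1 rmorphD rmorph1 /= fx addrC subrK.
- rewrite -(pair_bigA _
    (fun i j : 'I_p => eigen_idem p (pi y) i * eigen_idem p (pi z) j)).
  under eq_bigr do rewrite -mulr_sumr quot_sum_eigen_idem // mulr1.
  exact: quot_sum_eigen_idem.
- by move=> i j; exact: mpoly_quotC.
- move=> i; have [fZ fx fy fz] := fP i.
  apply: ord3_ind; rewrite ?(fx, fy, fz) ?gt // rmorph_nat /e.
    rewrite [LHS]mpoly_quotC [RHS]mpoly_quotC !mulrA; congr (_ * _).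
    exact/esym/eigen_idem_mul.
  rewrite -[LHS]mulrA -[RHS]mulrA; congr (_ * _).
  rewrite [LHS]mpoly_quotC [RHS]mpoly_quotC.
  exact/esym/eigen_idem_mul.
- move=> [i1 i2] [j1 j2]; have [fZ fx fy fz] := fP (i1, i2).
  have fey j : f (i1, i2) (eigen_idem p (pi y) (j : 'I_p)) = (i1 == j)%:R.
    by rewrite rmorph_eigen_idem fy (eigen_idem_natr p_pr char_k).
  have fez j : f (i1, i2) (eigen_idem p (pi z) (j : 'I_p)) = (i2 == j)%:R.
    by rewrite rmorph_eigen_idem fz (eigen_idem_natr p_pr char_k).
  rewrite xpair_eqE -mulnb natrM; apply: (etrans (rmorphM _ _ _)).
  by congr (_ * _); [exact: fey | exact: fez].
Qed.

End SemisimplePresentations.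

(** * The Weyl relation *)

Section WeylMatrices.
Variables (k : fieldType) (m : nat).
Hypothesis p0 : m.+1%:R = 0 :> k.
Local Notation M := 'M[k]_m.+1.

(* raising and lowering c are the matrices of t and c d/dt on k[t]/(t^m.+1);    *)
(* basis_col n is t^n, hence 0 for n > m.                                       *)
Definition raising : M := \matrix_(i, j) (i == j.+1 :> nat)%:R.

Definition lowering (c : k) : M := \matrix_(i, j) (c * j%:R * (i.+1 == j)%:R).

Definition basis_col (n : nat) : 'cV[k]_m.+1 := \col_i (i == n :> nat)%:R.

Lemma basis_col_ge n : (m < n)%N -> basis_col n = 0.
Proof.
move=> mn; apply/colP=> i; rewrite !mxE; case: eqP => // iE.
by have := ltn_ord i; rewrite iE ltnS leqNgt mn.
Qed.

Lemma basis_colE (j : 'I_m.+1) : basis_col j = delta_mx j 0.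
Proof. by apply/colP=> i; rewrite !mxE eqxx andbT. Qed.

Lemma mulmx_basis_col (N : M) (j : 'I_m.+1) : N *m basis_col j = col j N.
Proof. by rewrite basis_colE colE. Qed.

Lemma basis_col_ext (N N' : M) :
  (forall n, (n <= m)%N -> N *m basis_col n = N' *m basis_col n) -> N = N'.
Proof.
move=> H; apply/matrixP=> i j; have := H j (ltn_ord j).
by rewrite !mulmx_basis_col => /colP/(_ i); rewrite !mxE.
Qed.

Lemma raising_basis_col n : raising *m basis_col n = basis_col n.+1.
Proof.
have [nm|mn] := leqP n m; last by rewrite !basis_col_ge ?mulmx0 // ltnW.
rewrite -[n]/(nat_of_ord (Ordinal (nm : (n < m.+1)%N))) mulmx_basis_col.
by apply/colP=> i; rewrite !mxE.
Qed.

Lemma lowering_basis_col c n :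
  lowering c *m basis_col n = (c * n%:R) *: basis_col n.-1.
Proof.
have [nm|] := leqP n m.
  rewrite -[n in LHS]/(nat_of_ord (Ordinal (nm : (n < m.+1)%N))) mulmx_basis_col.
  apply/colP=> i; rewrite !mxE /=; case: n nm => [|n] nm; last by rewrite eqSS.
  by rewrite !(mulr0, mul0r).
(* At [n = m.+1] the left side is zero but t^m on the right is not; its coefficient vanishes because
   [m.+1%:R = 0]. This is why d/dt is defined on k[t]/(t^m.+1). *)
rewrite leq_eqVlt => /orP[/eqP<-|mn].
  by rewrite basis_col_ge // mulmx0 p0 mulr0 scale0r.
have mn1 : (m < n.-1)%N by rewrite -ltnS (ltn_predK mn).
by rewrite !basis_col_ge ?mulmx0 ?scaler0 // ltnW.
Qed.

Lemma raisingX_basis_col i n : raising ^+ i *m basis_col n = basis_col (n + i).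
Proof.
elim: i => [|i IH]; first by rewrite mul1mx addn0.
by rewrite exprS -mulmxA IH raising_basis_col addnS.
Qed.

Lemma loweringX_basis_col c i n :
  lowering c ^+ i *m basis_col n = (c ^+ i * (n ^_ i)%:R) *: basis_col (n - i).
Proof.
elim: i => [|i IH]; first by rewrite mul1mx mul1r scale1r subn0.
rewrite exprS -mulmxA IH -scalemxAr lowering_basis_col scalerA subnS; congr (_ *: _).
by rewrite ffactnSr natrM exprS; ring.
Qed.

Lemma raisingXp : raising ^+ m.+1 = 0.
Proof.
apply: basis_col_ext => n _; rewrite raisingX_basis_col mul0mx basis_col_ge //.
by rewrite addnS ltnS leq_addl.
Qed.

Lemma loweringXp c : lowering c ^+ m.+1 = 0.
Proof.
apply: basis_col_ext => n nm.
by rewrite loweringX_basis_col mul0mx ffact_small // mulr0 scale0r.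
Qed.

Lemma lowering_raising c :
  lowering c * raising - raising * lowering c = c%:A.
Proof.
apply: basis_col_ext => n nm.
rewrite mulmxBl -!mulmxA raising_basis_col !lowering_basis_col -scalemxAr.
rewrite raising_basis_col -scalemxAl mul1mx.
case: n nm => [|n] nm; first by rewrite mulr0 scale0r subr0 mulr1.
by rewrite -scalerBl -mulrBr -natrB // subSnn mulr1.
Qed.

(** Applied to t^n, the rightmost factor gives t^(n + m - b). This is truncated to zero if n > b and
    killed by the m-th derivative if n < b; for n = b the derivative leaves the constant c^m m!,
    which t^j moves to position j. *)
Lemma matrix_unit_weyl c (j b : 'I_m.+1) :
  raising ^+ j * lowering c ^+ m * raising ^+ (m - b)
  = (c ^+ m * m`!%:R) *: delta_mx j b.
Proof.
apply: basis_col_ext => n nm.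
have bm : (b <= m)%N := ltn_ord b.
have deltaE : delta_mx j b *m basis_col n = basis_col j *+ (b == n :> nat).
  rewrite -[n]/(nat_of_ord (Ordinal (nm : (n < m.+1)%N))) !basis_colE.
  by rewrite mul_delta_mx_cond.
rewrite -!mulmxA raisingX_basis_col -scalemxAl deltaE.
have [bn|nb|<-] := ltngtP b n.
- by rewrite basis_col_ge ?mulmx0 ?scaler0 // addnBA // ltn_subRL ltn_add2r.
- rewrite loweringX_basis_col ffact_small ?mulr0 ?scale0r ?mulmx0 ?scaler0 //.
  by rewrite addnBA // ltn_subLR ?ltn_add2r // (leq_trans bm) // leq_addl.
rewrite subnKC // loweringX_basis_col ffactnn subnn -scalemxAr.
by rewrite raisingX_basis_col.
Qed.
End WeylMatrices.

(** * Consequences of [x, y] = z with z central, in an arbitrary ring *)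

Section WeylRelations.
Variables (R : pzRingType) (m : nat) (x y z : R).
Hypotheses (p0 : m.+1%:R = 0 :> R) (wilson : m`!%:R = -1 :> R).
Hypothesis natr_inj : forall n (a : R), (0 < n <= m)%N -> a *+ n = 0 -> a = 0.
Hypotheses (xy : x * y = y * x + z) (zx : z * x = x * z) (zy : z * y = y * z).
Hypotheses (xp : x ^+ m.+1 = 0) (yp : y ^+ m.+1 = 0).

Let zxX i : z * x ^+ i = x ^+ i * z.
Proof. exact: commrX. Qed.

Let zyX i : z * y ^+ i = y ^+ i * z.
Proof. exact: commrX. Qed.

(** The commutator with x is a derivation sending y to the central z. At [i = 0] the truncated
    exponent [i.-1] is harmless, its term having multiplicity zero. *)
Lemma weyl_mulXr i : x * y ^+ i = y ^+ i * x + (z * y ^+ i.-1) *+ i.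
Proof.
elim: i => [|i IH]; first by rewrite mulr0n addr0 mul1r mulr1.
rewrite exprS mulrA xy mulrDl -mulrA IH mulrDr mulrA -addrA; congr (_ + _).
rewrite mulrnAr mulrS addrC; congr (_ + _).
by case: i {IH} => [|i]; rewrite ?mulr0n // mulrA -zy -mulrA -exprS.
Qed.

Lemma weyl_mulXl i : x ^+ i * y = y * x ^+ i + (z * x ^+ i.-1) *+ i.
Proof.
elim: i => [|i IH]; first by rewrite mulr0n addr0 mul1r mulr1.
rewrite exprSr -mulrA xy mulrDr mulrA IH mulrDl -!mulrA -addrA; congr (_ + _).
rewrite -zxX mulrS addrC; congr (_ + _); rewrite mulrnAl -mulrA.
by case: i {IH} => [|i]; rewrite ?mulr0n // -exprSr.
Qed.

Let w := x ^+ m.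

Let xw : x * w = 0. Proof. by rewrite /w -exprS. Qed.
Let wx : w * x = 0. Proof. by rewrite /w -exprSr. Qed.

Lemma weyl_mulXw i : x * (y ^+ i * w) = z * (y ^+ i.-1 * w) *+ i.
Proof. by rewrite mulrA weyl_mulXr mulrDl -mulrA xw mulr0 add0r mulrnAl mulrA. Qed.

(** Since x kills w = x^m, it acts on the elements y^n w as z d/dt acts on t^n. *)
Lemma weyl_expXw a n :
  x ^+ a * (y ^+ n * w) = z ^+ a * (y ^+ (n - a) * w) *+ n ^_ a.
Proof.
elim: a => [|a IH]; first by rewrite !mul1r subn0.
have xzX : x * z ^+ a = z ^+ a * x by apply: commrX; exact: esym.
rewrite exprS -mulrA IH mulrnAr mulrA xzX -mulrA weyl_mulXw.
rewrite -subnS mulrnAr -mulrnA mulrA -exprSr ffactnSr; congr (_ *+ _).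
exact: mulnC.
Qed.

(* The sum of the matrix units; it turns out to be the projection onto the      *)
(* part of the algebra where z is invertible.                                   *)
Definition weyl_proj : R := - \sum_(j < m.+1) y ^+ j * w * y ^+ (m - j).
Local Notation u := weyl_proj.

(** In the product with w, x^m meets y^(m-j) w, of degree below m unless j = 0. The surviving term
    carries m!, and Wilson's -1 cancels the sign in [weyl_proj]. *)
Lemma weyl_proj_mulw : u * w = z ^+ m * w.
Proof.
rewrite mulNr mulr_suml (bigD1 ord0) //= big1 ?addr0 => [|j j0].
  rewrite subn0 mul1r -mulrA weyl_expXw subnn mul1r ffactnn.
  by rewrite -mulr_natr wilson mulrN1 opprK.
rewrite -!mulrA weyl_expXw ffact_small ?mulr0n ?mulr0 // ltn_subrL.
by case: (m) j j0 => [|?] [[]].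
Qed.

(** Multiplying by y on either side gives the same sum shifted by one index; the extreme terms
    contain y^(m+1) = 0. *)
Lemma weyl_proj_commy : y * u = u * y.
Proof.
rewrite mulrN mulNr; congr (- _); rewrite mulr_sumr mulr_suml.
rewrite big_ord_recr [RHS]big_ord_recl /= !mulrA -exprS yp !mul0r addr0.
rewrite subn0 -mulrA -exprSr yp mulr0 add0r; apply: eq_bigr => j _.
rewrite !mulrA -exprS -[RHS]mulrA -exprSr; congr (_ * _ ^+ _).
by rewrite /bump /= add1n subnSK.
Qed.

(** The extreme terms vanish by x w = w x = 0. In the others, moving x past a power of y produces
    multiples of the same element on both sides. *)
Lemma weyl_proj_commx : x * u = u * x.
Proof.
rewrite mulrN mulNr; congr (- _); rewrite mulr_sumr mulr_suml.
rewrite big_ord_recl [RHS]big_ord_recr /= mul1r mulrA xw mul0r add0r.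
rewrite subnn mulr1 -mulrA wx mulr0 addr0; apply: eq_bigr => j _.
rewrite mulrA weyl_mulXw /bump /= add1n.
have wyx n : w * y ^+ n * x = - (w * (z * y ^+ n.-1) *+ n).
  have := congr1 (fun r => w * r) (weyl_mulXr n); rewrite mulrA wx mul0r mulrDr.
  by move/esym/eqP; rewrite addr_eq0 mulrA => /eqP->; rewrite mulrnAr.
rewrite -!mulrA [w * (_ * x)]mulrA wyx -subnS mulrN mulrnAr mulrnAl.
have -> : z * (y ^+ j * w) * y ^+ (m - j.+1) = y ^+ j * (w * (z * y ^+ (m - j.+1))).
  by rewrite mulrA zyX -!mulrA; congr (_ * _); rewrite !mulrA /w zxX.
(* The multiplicities j + 1 and m - j have opposite signs on the two sides and add up to m + 1,
   which is zero in [R]. *)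
apply/eqP; rewrite -addr_eq0 -mulrnDr addSn subnKC ?(ltnW (ltn_ord j)) //.
by rewrite -mulr_natr p0 mulr0.
Qed.

Lemma weyl_proj_commz : z * u = u * z.
Proof.
rewrite mulrN mulNr; congr (- _); rewrite mulr_sumr mulr_suml.
by apply: eq_bigr => j _; rewrite -!mulrA -zyX !mulrA zyX -[_ * z * w]mulrA zxX !mulrA.
Qed.

(** Stands in for a dimension count: wherever z^m = 1, it says that the lifted matrix units sum to
    1. *)
Lemma weyl_projE : u * z ^+ m = z ^+ m * z ^+ m.
Proof.
pose d := z ^+ m - u.
have dx : GRing.comm d x.
  by apply: commr_sym; apply: commrB; [exact: commrX|exact: weyl_proj_commx].
have dy : GRing.comm d y.
  by apply: commr_sym; apply: commrB; [exact: commrX|exact: weyl_proj_commy].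
have dz : GRing.comm d z.
  by apply: commr_sym; apply: commrB; [exact: commrX|exact: weyl_proj_commz].
(* d is central and kills x ^+ m; taking commutators with y trades each factor  *)
(* x for a factor z.                                                            *)
suff H i : (i <= m)%N -> d * (z ^+ i * x ^+ (m - i)) = 0.
  apply/eqP; rewrite eq_sym -subr_eq0 -mulrBl; have := H m (leqnn m).
  by rewrite subnn mulr1 => ->.
elim: i => [|i IH] im; first by rewrite mul1r subn0 mulrBl weyl_proj_mulw subrr.
have {IH} := IH (ltnW im); rewrite -(subnSK im) => IH.
apply: (natr_inj (n := (m - i.+1).+1)); first by rewrite subnSK // subn_gt0 im leq_subr.
set q := (m - i.+1)%N in IH *.
rewrite exprSr -mulrA -2!mulrnAr; have := weyl_mulXl q.+1 => /= E.
have {E} -> : z * x ^+ q *+ q.+1 = x ^+ q.+1 * y - y * x ^+ q.+1.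
  by rewrite E addrC addKr.
have yzX : y * z ^+ i = z ^+ i * y by apply: commrX; exact: esym.
have Ey : d * (z ^+ i * (y * x ^+ q.+1)) = y * (d * (z ^+ i * x ^+ q.+1)).
  by rewrite [RHS]mulrA -dy -[RHS]mulrA [y * (z ^+ i * _)]mulrA yzX -!mulrA.
have Ex : d * (z ^+ i * (x ^+ q.+1 * y)) = d * (z ^+ i * x ^+ q.+1) * y.
  by rewrite !mulrA.
by rewrite !mulrBr Ex Ey IH mul0r mulr0 subrr.
Qed.

End WeylRelations.

Lemma idem_mul_mul (R : pzRingType) (i a b : R) :
  i * i = i -> a * i = i * a -> i * a * (i * b) = i * (a * b).
Proof. by move=> ii ai; rewrite mulrA -(mulrA i a i) ai mulrA ii mulrA. Qed.

(** * The algebra C10, through generation and the universal property of the free algebra *)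

Section WeylPresentation.
Variables (k : fieldType) (m : nat).
Local Notation p := m.+1.
Hypotheses (p_pr : prime p) (char_k : p \in [pchar k]).

Variables (A : algType k) (gen : 'I_3 -> A).
Hypothesis gen_generates : generates gen.
Hypothesis gen_lift : forall (B : algType k) (v : 'I_3 -> B),
  exists f : {lrmorphism A -> B}, forall j, f (gen j) = v j.

Local Notation X := (gen (@Ordinal 3 0 isT)).
Local Notation Y := (gen (@Ordinal 3 1 isT)).
Local Notation Z := (gen (@Ordinal 3 2 isT)).

Let rels : seq A :=
  [:: X * Y - Y * X - Z; X * Z - Z * X; Y * Z - Z * Y; X ^+ p; Y ^+ p; Z ^+ p - Z].
Local Notation Q := (quot_alg rels).
Let x : Q := quot_pi rels X.
Let y : Q := quot_pi rels Y.
Let z : Q := quot_pi rels Z.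

Lemma weyl_lift (B : algType k) (a b c : B) :
  a * b - b * a = c -> a * c = c * a -> b * c = c * b ->
  a ^+ p = 0 -> b ^+ p = 0 -> c ^+ p = c ->
  exists f : {rmorphism Q -> B},
    [/\ forall d u, f (d *: u) = d *: f u, f x = a, f y = b & f z = c].
Proof.
move=> ab ac bc ap bp cp.
have [F FX] := @gen_lift _ (fun j : 'I_3 => nth 0 [:: a; b; c] j).
have F0 : F X = a by rewrite FX.
have F1 : F Y = b by rewrite FX.
have F2 : F Z = c by rewrite FX.
have [|f [fZ fpi]] := @quot_lift _ _ rels _ F.
  move=> r; rewrite !inE => /or4P[/eqP->|/eqP->|/eqP->|/or3P[]/eqP->];
    by rewrite ?rmorphB ?rmorphM ?rmorphXn /= ?(F0, F1, F2) ?ab ?ac ?bc ?cp ?subrr.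
by exists f; rewrite !fpi.
Qed.

Let p0k : p%:R = 0 :> k. Proof. exact: pcharf0. Qed.
Let p0 : p%:R = 0 :> Q. Proof. exact: quot_natp0. Qed.

Let wilsonQ : m`!%:R = -1 :> Q.
Proof.
apply/eqP; rewrite -addr_eq0 natr1 -scaler_nat.
have := Wilson (prime_gt1 p_pr); rewrite p_pr => /esym/dvdnP[d ->].
by rewrite natrM p0k mulr0 scale0r.
Qed.

Let natrQ_inj n (a : Q) : (0 < n <= m)%N -> a *+ n = 0 -> a = 0.
Proof.
move=> /andP[n0 nm] /eqP; rewrite -scaler_nat => /eqP na0.
have nk0 : n%:R != 0 :> k.
  by rewrite -(dvdn_pcharf char_k) gtnNdvd.
by rewrite -(scale1r a) -(mulVf nk0) -scalerA na0 scaler0.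
Qed.

Let xy : x * y = y * x + z.
Proof.
rewrite -!rmorphM -rmorphD; apply: quot_relB.
by rewrite opprD addrA inE eqxx.
Qed.

Let zx : z * x = x * z.
Proof. by apply/esym; rewrite -!rmorphM; apply: quot_relB; rewrite !inE eqxx ?orbT. Qed.

Let zy : z * y = y * z.
Proof. by apply/esym; rewrite -!rmorphM; apply: quot_relB; rewrite !inE eqxx ?orbT. Qed.

Let xp : x ^+ p = 0.
Proof. by rewrite -rmorphXn; apply: quot_rel0; rewrite !inE eqxx ?orbT. Qed.

Let yp : y ^+ p = 0.
Proof. by rewrite -rmorphXn; apply: quot_rel0; rewrite !inE eqxx ?orbT. Qed.

Let zp : z ^+ p = z.
Proof. by rewrite -rmorphXn; apply: quot_relB; rewrite !inE eqxx ?orbT. Qed.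

Let e (i : nat) : Q := eigen_idem p z i.

Let ex i : x * e i = e i * x.
Proof. exact/comm_eigen_idem/esym. Qed.
Let ey i : y * e i = e i * y.
Proof. exact/comm_eigen_idem/esym. Qed.
Let ez i : e i * z = z * e i.
Proof. by apply/esym/comm_eigen_idem. Qed.
Let ze i : z * e i = i%:R * e i.
Proof. exact: eigen_idem_mul. Qed.

Let e0z : e 0%N * z = 0. Proof. by rewrite ez ze mul0r. Qed.

Let m_gt0 : (0 < m)%N. Proof. exact: prime_gt1 p_pr. Qed.

Let e0e0 : e 0%N * e 0%N = e 0%N.
Proof.
rewrite {2}/e /eigen_idem subr0 mulrBr mulr1 /=.
by rewrite -(prednK m_gt0) exprS mulrA e0z mul0r subr0.
Qed.

(** The row index is any natural number, so that [n = m.+1], where y^n = 0, matches [basis_col]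
    vanishing beyond [m]. The sign is the inverse of m!. *)
Let weyl_unit (n : nat) (b : 'I_p) : Q := - (y ^+ n * x ^+ m * y ^+ (m - b)).

Let of_mx (N : 'M[k]_p) : Q := \sum_j \sum_b N j b *: weyl_unit j b.

Let of_mxD : {morph of_mx : N N' / N + N'}.
Proof.
move=> N N'; rewrite /of_mx -big_split; apply: eq_bigr => j _ /=.
by rewrite -big_split; apply: eq_bigr => b _; rewrite mxE scalerDl.
Qed.

Let of_mxZ c N : of_mx (c *: N) = c *: of_mx N.
Proof.
rewrite /of_mx scaler_sumr; apply: eq_bigr => j _.
by rewrite scaler_sumr; apply: eq_bigr => b _; rewrite mxE scalerA.
Qed.

Let of_mx_sum (I : finType) (N : I -> 'M_p) : of_mx (\sum_i N i) = \sum_i of_mx (N i).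
Proof. by apply: (big_morph of_mx of_mxD); rewrite -(scale0r 0) of_mxZ scale0r. Qed.

Let of_mx_delta (j b : 'I_p) : of_mx (delta_mx j b) = weyl_unit j b.
Proof.
rewrite /of_mx (bigD1 j) //= (bigD1 b) //= mxE !eqxx scale1r !big1 ?addr0 //.
  move=> j' /negPf jj'; rewrite big1 // => b' _; by rewrite mxE jj' scale0r.
by move=> b' /negPf bb'; rewrite mxE bb' andbF scale0r.
Qed.

Let of_mx_basis_col n b : of_mx (basis_col k m n *m delta_mx 0 b) = weyl_unit n b.
Proof.
have [nm|mn] := leqP n m; last first.
  rewrite basis_col_ge // mul0mx -(scale0r 0) of_mxZ scale0r.
  by rewrite /weyl_unit -(subnK mn) exprD yp mulr0 !mul0r oppr0.
rewrite -[n]/(nat_of_ord (Ordinal (nm : (n < p)%N))) basis_colE mul_delta_mx.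
exact: of_mx_delta.
Qed.

(** By linearity, matrix units suffice. The factor [c] is [1] for [raising], and [e i] for
    [lowering], where the comparison holds only after z has become the scalar i. *)
Let of_mx_mul (c r : Q) (L N : 'M_p) :
  (forall j b, c * of_mx (L *m delta_mx j b) = c * r * weyl_unit j b) ->
  c * of_mx (L * N) = c * r * of_mx N.
Proof.
move=> cL.
have -> : L * N = \sum_j \sum_b N j b *: (L *m delta_mx j b).
  rewrite [in LHS](matrix_sum_delta N) mulr_sumr; apply: eq_bigr => j _.
  by rewrite mulr_sumr; apply: eq_bigr => b _; rewrite -scalerAr.
rewrite of_mx_sum mulr_sumr [in RHS]/of_mx mulr_sumr; apply: eq_bigr => j _.
rewrite of_mx_sum !mulr_sumr; apply: eq_bigr => b _.
by rewrite of_mxZ -!quot_scalerAr cL.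
Qed.

Let of_mx_raising N : of_mx (raising k m * N) = y * of_mx N.
Proof.
rewrite -[LHS]mul1r (of_mx_mul (r := y)) ?mul1r // => j b; rewrite !mul1r.
rewrite -(mul_delta_mx (0 : 'I_1)) -basis_colE mulmxA raising_basis_col.
by rewrite of_mx_basis_col /weyl_unit mulrN !mulrA -exprS.
Qed.

(** On y^j w, x acts as j z y^(j-1) w by [weyl_mulXw], and [e i] replaces z by i; this is the action
    of i d/dt on t^j. *)
Let of_mx_lowering i N : e i * of_mx (lowering m i%:R * N) = e i * (x * of_mx N).
Proof.
rewrite [RHS]mulrA; apply: of_mx_mul => j b.
rewrite -(mul_delta_mx (0 : 'I_1)) -basis_colE mulmxA lowering_basis_col //.
rewrite -scalemxAl of_mxZ of_mx_basis_col /weyl_unit -quot_scalerAr !mulrN scalerN.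
congr (- _); rewrite -[RHS]mulrA [x * _]mulrA (weyl_mulXw xy zy xp).
rewrite [X in _ = _ * X]mulrnAl [RHS]mulrnAr -[z * _ * _]mulrA [e i * (z * _)]mulrA.
rewrite ez ze -[X in _ = X *+ _]mulrA [X in _ = X *+ _]mulr_natl.
by rewrite mulrC -scalerA !scaler_nat.
Qed.

Let weyl_proj_of_mx : of_mx 1 = weyl_proj m x y.
Proof.
rewrite /of_mx /weyl_proj -sumrN; apply: eq_bigr => j _.
rewrite (bigD1 j) //= mxE eqxx scale1r big1 ?addr0 // => b bj.
by rewrite mxE eq_sym (negPf bj) scale0r.
Qed.

(** The eigenvalue i + 1 is nonzero modulo p, so its (p-1)-st power is 1 by Fermat. *)
Let e_zm (i : 'I_m) : e i.+1 * z ^+ m = e i.+1.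
Proof.
have zX n : z ^+ n * e i.+1 = i.+1%:R ^+ n * e i.+1.
  elim: n => [|n IH]; first by rewrite !mul1r.
  by rewrite !exprS -!mulrA IH -natrX mulr_natl !mulrnAr ze.
have ezX : e i.+1 * z ^+ m = z ^+ m * e i.+1 by apply: commrX; exact: ez.
rewrite ezX zX -natrX -scaler_nat natrX.
have := expr_pred_natB p_pr char_k (lift ord0 i) ord0; rewrite subr0 /= => ->.
by rewrite scale1r mul1r.
Qed.

(** Multiplying [weyl_projE] by [e i.+1] turns both powers of z into 1. *)
Let e_proj (i : 'I_m) : e i.+1 * of_mx 1 = e i.+1.
Proof.
have zmu : z ^+ m * weyl_proj m x y = weyl_proj m x y * z ^+ m.
  apply/esym/commrX/esym; exact: weyl_proj_commz.
rewrite weyl_proj_of_mx -[in LHS](e_zm i) -mulrA zmu weyl_projE //.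
by rewrite mulrA !e_zm.
Qed.

Lemma weyl_iso :
  Q =~[k] (group_alg k ('Z_p * 'Z_p)%type * {ffun 'I_m -> 'M[k]_p})%type.
Proof.
have p1 := prime_gt1 p_pr.
pose s := ga_of k ((Zp1, 1)%g : 'Z_p * 'Z_p) - 1.
pose t := ga_of k ((1, Zp1)%g : 'Z_p * 'Z_p) - 1.
have s0 : s ^+ p = 0 by apply: ga_subr1_p; rewrite // pair_expg Zp1_expg // expg1n.
have t0 : t ^+ p = 0 by apply: ga_subr1_p; rewrite // pair_expg Zp1_expg // expg1n.
have [f0 [f0Z f0x f0y f0z]] : exists f : {rmorphism Q -> group_alg k ('Z_p * 'Z_p)%type},
    [/\ forall d u, f (d *: u) = d *: f u, f x = s, f y = t & f z = 0%:R].
  apply: weyl_lift; rewrite ?mulr0 ?mul0r //; last by rewrite expr0n.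
  apply/eqP; rewrite subr_eq0; apply/eqP/ga_mulC.
  by apply: pair_mulgC; exact: Zp_mulgC.
have p0M : p%:R = 0 :> 'M[k]_p by rewrite -scaler_nat p0k scale0r.
(* An index [i : 'I_m] stands for the nonzero eigenvalue [i.+1]. *)
have /fin_all_exists[fm fmP] (i : 'I_m) : exists f : {rmorphism Q -> 'M[k]_p},
    [/\ forall d u, f (d *: u) = d *: f u, f x = lowering m i.+1%:R,
        f y = raising k m & f z = i.+1%:R].
  apply: weyl_lift.
  - by rewrite lowering_raising // scaler_nat.
  - exact: commr_nat.
  - exact: commr_nat.
  - exact: loweringXp.
  - exact: raisingXp.
  - exact: expr_natp.
(* The commutator of x and y is z, and [e 0] kills z; cutting down by [e 0] therefore makes the
   images of the two group generators commute. *)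
have comm_e0xy : GRing.comm (1 + e 0 * x) (1 + e 0 * y).
  suff H : e 0 * x * (e 0 * y) = e 0 * y * (e 0 * x).
    apply: commrD; first exact: commr1.
    by apply/commr_sym/commrD; [exact: commr1 | exact/esym].
  by rewrite !(idem_mul_mul _ e0e0) // xy mulrDr e0z addr0.
have u1 u : u ^+ p = 0 -> (1 + u : Q) ^+ p = 1.
  by rewrite -{1 2}[p]expn1; exact: expr1Dpn.
have e0xp : (e 0 * x) ^+ p = 0 by rewrite exprMn_comm ?xp ?mulr0.
have e0yp : (e 0 * y) ^+ p = 0 by rewrite exprMn_comm ?yp ?mulr0.
have [g [gZ g1 g2]] := @ga_lift2 _ _ rels _ _ _ _ p1 p1
  (u1 _ e0xp) (u1 _ e0yp) comm_e0xy.
have gs : g s = e 0 * x by rewrite rmorphB rmorph1 /= g1 addrC addKr.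
have gt : g t = e 0 * y by rewrite rmorphB rmorph1 /= g2 addrC addKr.
have f0e (i : 'I_p) : f0 (e i) = (i == ord0)%:R.
  by rewrite rmorph_eigen_idem f0z (eigen_idem_natr p_pr char_k _ ord0 i) eq_sym.
have f0g : cancel g f0.
  have f0e0 : f0 (e 0) = 1 by rewrite (f0e ord0).
  by apply: ga_liftK2 => //;
    rewrite ?(g1, g2) rmorphD rmorph1 rmorphM /= f0e0 mul1r ?(f0x, f0y) addrC subrK.
have fme i (j : 'I_p) : fm i (e j) = (lift ord0 i == j)%:R.
  have [_ _ _ fz] := fmP i.
  by rewrite rmorph_eigen_idem fz -(eigen_idem_natr p_pr char_k).
have fmK i N : fm i (of_mx N) = N.
  have [fZ fx fy fz] := fmP i.
  rewrite [RHS]matrix_sum_delta rmorph_sum; apply: eq_bigr => j _.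
  rewrite rmorph_sum; apply: eq_bigr => b _; rewrite fZ; congr (_ *: _).
  rewrite rmorphN !rmorphM !rmorphXn /= fx fy matrix_unit_weyl //.
  (* [matrix_unit_weyl] leaves the scalar - (i+1)^m m!, which is 1 by Fermat and Wilson. *)
  have := expr_pred_natB p_pr char_k (lift ord0 i) ord0; rewrite subr0 /= => ->.
  rewrite mul1r -scaleNr -[RHS]scale1r; congr (_ *: _); apply/eqP.
  rewrite eqr_oppLR -addr_eq0 natr1 -(dvdn_pcharf char_k).
  by rewrite -Wilson.
have [Fm FmE] := ffun_rmorphism fm; have [F FE] := pair_rmorphism f0 Fm.
pose G (B : group_alg k ('Z_p * 'Z_p)%type * {ffun 'I_m -> 'M[k]_p}) :=
  e 0 * g B.1 + \sum_i e (lift ord0 i : 'I_p) * of_mx (B.2 i).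
(* Compatibility with a generator [r] is reduced to one condition on the part z = 0 and one on each
   matrix block. *)
have Gmul r : (forall i, r * e i = e i * r) -> e 0 * g (f0 r) = e 0 * r ->
    (forall (i : 'I_m) N, e i.+1 * of_mx (fm i r * N) = e i.+1 * (r * of_mx N)) ->
    forall B, G (F r * B) = r * G B.
  move=> re r0 rm B; rewrite /G FE mulrDr mulr_sumr; congr (_ + _).
    by rewrite rmorphM [LHS]mulrA r0 -re [RHS]mulrA.
  by apply: eq_bigr => i _; rewrite ffunE FmE ffunE rm [LHS]mulrA -re [RHS]mulrA.
apply: (@quot_iso _ _ _ _ _ _ _ F G gen_generates).
- move=> c u; rewrite !FE f0Z; congr pair; apply/ffunP=> i; rewrite !(FmE, ffunE).
  by have [-> _ _ _] := fmP i.
- move=> B B'; rewrite /G rmorphD mulrDr addrACA -big_split; congr (_ + _).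
  by apply: eq_bigr => i _; rewrite ffunE of_mxD mulrDr.
- move=> c B; rewrite /G gZ scalerDr -quot_scalerAr scaler_sumr; congr (_ + _).
  by apply: eq_bigr => i _; rewrite ffunE of_mxZ -quot_scalerAr.
- rewrite /G rmorph1 mulr1 -[RHS](quot_sum_eigen_idem p_pr char_k rels Z).
  rewrite big_ord_recl; congr (_ + _); apply: eq_bigr => i _.
  by rewrite ffunE e_proj.
- apply: ord3_ind; apply: Gmul.
  + exact: ex.
  + by rewrite f0x gs mulrA e0e0.
  + by move=> i N; have [_ -> _ _] := fmP i; exact: of_mx_lowering.
  + exact: ey.
  + by rewrite f0y gt mulrA e0e0.
  + by move=> i N; have [_ _ -> _] := fmP i; rewrite of_mx_raising.
  + by move=> i; exact/esym/ez.
  + by rewrite f0z rmorph0 mulr0 e0z.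
  + move=> i N; have [_ _ _ ->] := fmP i.
    rewrite [RHS]mulrA ez ze -[RHS]mulrA [RHS]mulr_natl.
    by rewrite mulr_natl -scaler_nat of_mxZ scaler_nat mulrnAr.
- move=> B; rewrite FE /G; case: B => b N.
  rewrite -[(b, N).1]/b -[(b, N).2]/N; congr pair.
    rewrite rmorphD rmorphM f0g (f0e ord0) mul1r rmorph_sum big1 ?addr0 // => i _.
    by rewrite rmorphM f0e mul0r.
  apply/ffunP=> i; rewrite FmE ffunE rmorphD rmorphM (fme i ord0) mul0r add0r.
  rewrite rmorph_sum (bigD1 i) // big1 => [|i' /andP[_ /negPf ii']].
    by rewrite [LHS]addr0 rmorphM fme eqxx mul1r fmK.
  by rewrite rmorphM fme (inj_eq lift_inj) eq_sym ii' mul0r.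
Qed.

End WeylPresentation.

Lemma C10_iso (p : nat) (k : fieldType) :
  prime p -> p \in [pchar k] ->
  C10 k p =~[k]
    (group_alg k ('Z_p * 'Z_p)%type * {ffun 'I_p.-1 -> 'M[k]_p})%type.
Proof.
case: p => // m p_pr char_k.
have iso := weyl_iso p_pr char_k (@free_alg_generates k 3) (@free_alg_lift k 3).
exact: iso.
Qed.

(* C_n is the additive group 'Z_n (n = p, p ^ 2, p ^ 3 > 1); the direct sum of  *)
(* n copies of A is {ffun 'I_n -> A} with the pointwise product.               *)
Theorem proposition4p1 (p : nat) (k : fieldType)
    (p_prime : prime p) (char_k : p \in [pchar k]) :
  (* (a) *)
  [/\ A2 k p =~[k] C2 k p,
      A2 k p =~[k] group_alg k 'Z_(p ^ 3)
    & C2 k p =~[k] group_alg k 'Z_(p ^ 3)] /\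
  (* (b) *)
  [/\ A3 k p = C4 k p :> pzRingType,
      A3 k p = C4 k p :> lmodType k,
      A3 k p =~[k] group_alg k ('Z_p * 'Z_p * 'Z_p)%type
    & C4 k p =~[k] group_alg k ('Z_p * 'Z_p * 'Z_p)%type] /\
  (* (c) *)
  [/\ A4 k p =~[k] C3 k p,
      A4 k p =~[k] group_alg k ('Z_p * 'Z_(p ^ 2))%type
    & C3 k p =~[k] group_alg k ('Z_p * 'Z_(p ^ 2))%type] /\
  (* (d) *)
  C7 k p =~[k] {ffun 'I_p -> group_alg k ('Z_p * 'Z_p)%type} /\
  (* (e) *)
  C8 k p =~[k] {ffun 'I_p -> group_alg k 'Z_(p ^ 2)} /\
  (* (f) *)
  C9 k p =~[k] {ffun 'I_(p ^ 2) -> group_alg k 'Z_p} /\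
  (* (g) *)
  C10 k p =~[k]
    (group_alg k ('Z_p * 'Z_p)%type * {ffun 'I_p.-1 -> 'M[k]_p})%type.
Proof.
have A2G := A2_iso p_prime char_k; have C2G := C2_iso p_prime char_k.
have A3G := A3_iso p_prime char_k.
have A4G := A4_iso p_prime char_k; have C3G := C3_iso p_prime char_k.
split.
  by split; [exact: alg_iso_trans A2G (alg_iso_sym C2G) | exact: A2G | exact: C2G].
(* [A3] and [C4] are quotients by the same list of relations, hence convertible as rings and as
   modules. *)
split; first by split; [reflexivity | reflexivity | exact: A3G | exact: A3G].
split.
  by split; [exact: alg_iso_trans A4G (alg_iso_sym C3G) | exact: A4G | exact: C3G].
split; first exact: C7_iso.
split; first exact: C8_iso.
split; first exact: C9_iso.
exact: C10_iso.
Qed.
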